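(* Let $\Lambda$ and $\Omega$ be row-finite $k$-graphs without sources and $\mathsf{k}$ any field. Let $\phi:T_\Lambda\to T_\Omega$ be a $\mathbb{Z}^k$-monoid isomorphism. Then $\mathrm{KP}_{\mathsf{k}}(\Lambda)$ is semisimple if and only if $\mathrm{KP}_{\mathsf{k}}(\Omega)$ is semisimple. Moreover, in this case (that is, when these algebras are semisimple), if $T_\Lambda$ is finitely generated as a $\mathbb{Z}^k$-monoid, then $\mathrm{KP}_{\mathsf{k}}(\Lambda)\cong\mathrm{KP}_{\mathsf{k}}(\Omega)$ as $\mathsf{k}$-algebras.
   Context: **$k$-graphs.** $\mathbb{N}=\{0,1,2,\dots\}$, $k\ge 1$, $e_i$ is the $i$-th standard generator of $\mathbb{N}^k$. A $k$-graph is a countable small category $\Lambda$ with object set $\Lambda^0$ (identified with the identity morphisms), range and source maps $r,s:\Lambda\to\Lambda^0$, and a functor $d:\Lambda\to\mathbb{N}^k$ with the unique factorization property: if $d(\lambda)=m+n$ there are unique $\mu_1,\mu_2\in\Lambda$ with $\lambda=\mu_1\mu_2$, $d(\mu_1)=m$, $d(\mu_2)=n$ (the product $\mu_1\mu_2$ is defined iff $s(\mu_1)=r(\mu_2)$). $v\Lambda^n=\{\lambda: r(\lambda)=v, d(\lambda)=n\}$. $\Lambda$ is row-finite if every $v\Lambda^n$ is finite, and has no sources if every $v\Lambda^n$ is nonempty. **Talented monoid.** $T_\Lambda$ is the commutative monoid generated by symbols $v(n)$ ($v\in\Lambda^0$, $n\in\mathbb{Z}^k$) subject to $v(n)=\sum_{\alpha\in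 v\Lambda^{e_i}}s(\alpha)(n+e_i)$ for all $v$, $n$ and $i\in\{1,\dots,k\}$ with $v\Lambda^{e_i}\neq\emptyset$. $\mathbb{Z}^k$ acts on it by monoid automorphisms determined by ${}^{n}v(m)=v(m+n)$. A $\mathbb{Z}^k$-monoid isomorphism is a $\mathbb{Z}^k$-equivariant monoid isomorphism. A $\mathbb{Z}^k$-monoid $M$ is finitely generated as a $\mathbb{Z}^k$-monoid if there is a finite $A\subseteq M$ such that every $x\in M$ is a finite sum $\sum_i{}^{\alpha_i}a_i$ with $\alpha_i\in\mathbb{Z}^k$, $a_i\in A$ (not necessarily distinct). **Kumjian–Pask algebra.** Let $\Lambda^{\neq0}=\{\lambda: d(\lambda)\ne 0\}$. $\mathrm{KP}_{\mathsf{k}}(\Lambda)$ is the universal $\mathsf{k}$-algebra generated by elements $p_v$ ($v\in\Lambda^0$), $s_\lambda,s_{\lambda^*}$ ($\lambda\in\Lambda^{\neq 0}$) subject to: (KP1) $p_up_v=\delta_{u,v}p_u$; (KP2) $s_\lambda s_\mu=s_{\lambda\mu}$, $s_{\mu^*}s_{\lambda^*}=s_{(\lambda\mu)^*}$ when $s(\lambda)=r(\mu)$, and $p_{r(\lambda)}s_\lambda=s_\lambda=s_\lambda p_{s(\lambda)}$, $p_{s(\lambda)}s_{\lambda^*}=s_{\lambda^*}=s_{\lambda^*}p_{r(\lambda)}$; (KP3) $s_{\lambda^*}s_\mu=\delta_{\lambda,\mu}p_{s(\lambda)}$ when $d(\lambda)=d(\mu)$; (KP4) $p_v=\sum_{\lambda\in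 v\Lambda^n}s_\lambda s_{\lambda^*}$ for all $v\in\Lambda^0$, $n\in\mathbb{N}^k$ (with $s_v=s_{v^*}=p_v$ for $v\in\Lambda^0$). It is semisimple if it equals its socle, the sum of its minimal left ideals. *)

(* Defs.v *)
From HB Require Import structures.
From mathcomp Require Import all_boot all_order all_algebra.
From mathcomp Require Import boolp classical_sets.

Set Implicit Arguments.
Unset Strict Implicit.
Unset Printing Implicit Defensive.

Import GRing.Theory.
Local Open Scope ring_scope.
Local Open Scope quotient_scope.

Inductive mterm (X : Type) : Type :=
  | MZero : mterm X
  | MAdd : mterm X -> mterm X -> mterm X
  | MGen : X -> mterm X.
Arguments MZero {X}.

(* The least monoid congruence containing the relations [rel] and making the
   quotient commutative. *)
Inductive mcong (X : Type) (rel : mterm X -> mterm X -> Prop) :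
    mterm X -> mterm X -> Prop :=
  | mcong_rel a b : rel a b -> mcong rel a b
  | mcong_refl a : mcong rel a a
  | mcong_sym a b : mcong rel a b -> mcong rel b a
  | mcong_trans a b c : mcong rel a b -> mcong rel b c -> mcong rel a c
  | mcong_add a a' b b' :
      mcong rel a a' -> mcong rel b b' -> mcong rel (MAdd a b) (MAdd a' b')
  | mcong_addA a b c : mcong rel (MAdd a (MAdd b c)) (MAdd (MAdd a b) c)
  | mcong_addC a b : mcong rel (MAdd a b) (MAdd b a)
  | mcong_add0 a : mcong rel (MAdd MZero a) a.

HB.instance Definition _ (X : Type) := gen_eqMixin (mterm X).
HB.instance Definition _ (X : Type) := gen_choiceMixin (mterm X).

Section PresentedMonoid.
Context (X : Type) (rel : mterm X -> mterm X -> Prop).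

Definition mcongb (a b : mterm X) : bool := `[< mcong rel a b >].

Lemma mcongb_refl : reflexive mcongb.
Proof. by move=> a; apply/asboolP; exact: mcong_refl. Qed.

Lemma mcongb_sym : symmetric mcongb.
Proof. by move=> a b; apply/asboolP/asboolP; exact: mcong_sym. Qed.

Lemma mcongb_trans : transitive mcongb.
Proof.
by move=> b a c /asboolP ab /asboolP bc; apply/asboolP; exact: mcong_trans bc.
Qed.

Canonical mcong_equiv := EquivRel mcongb mcongb_refl mcongb_sym mcongb_trans.

Definition presmon : Type := {eq_quot mcong_equiv}.
HB.instance Definition _ := Choice.on presmon.
HB.instance Definition _ := EqQuotient.on presmon.

Definition mgen (x : X) : presmon := \pi_presmon (MGen x).
Definition presmon_zero : presmon := \pi_presmon MZero.
Definition presmon_add : presmon -> presmon -> presmon :=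
  lift_op2 presmon (@MAdd X).

Lemma presmon_piP (a b : mterm X) :
  mcong rel a b <-> \pi_presmon a = \pi_presmon b.
Proof.
by split=> [ab|/eqmodP /asboolP //]; apply/eqmodP/asboolP.
Qed.

Lemma presmon_repr (a : mterm X) : mcong rel (repr (\pi_presmon a)) a.
Proof. by apply/presmon_piP; rewrite reprK. Qed.

Lemma presmon_addE (a b : mterm X) :
  presmon_add (\pi_presmon a) (\pi_presmon b) = \pi_presmon (MAdd a b).
Proof. by unlock presmon_add; apply/presmon_piP; apply: mcong_add; exact: presmon_repr. Qed.

Lemma presmon_addA : associative presmon_add.
Proof.
elim/quotW=> x; elim/quotW=> y; elim/quotW=> z; rewrite !presmon_addE.
by apply/presmon_piP; exact: mcong_addA.
Qed.

Lemma presmon_addC : commutative presmon_add.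
Proof.
elim/quotW=> x; elim/quotW=> y; rewrite !presmon_addE.
by apply/presmon_piP; exact: mcong_addC.
Qed.

Lemma presmon_add0 : left_id presmon_zero presmon_add.
Proof.
elim/quotW=> x; rewrite presmon_addE.
by apply/presmon_piP; exact: mcong_add0.
Qed.

HB.instance Definition _ :=
  GRing.isNmodule.Build presmon presmon_addA presmon_addC presmon_add0.

End PresentedMonoid.

Fixpoint meval (X : Type) (M : nmodType) (f : X -> M) (a : mterm X) : M :=
  match a with
  | MZero => 0
  | MAdd a b => meval f a + meval f b
  | MGen x => f x
  end.

Definition presmon_lift (X : Type) (rel : mterm X -> mterm X -> Prop)
  (M : nmodType) (f : X -> M) (x : presmon rel) : M := meval f (repr x).

Section PresentedMonoidLift.
Context (X : Type) (rel : mterm X -> mterm X -> Prop) (M : nmodType).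
Context (f : X -> M).
Context (f_rel : forall a b, rel a b -> meval f a = meval f b).

Lemma meval_cong (a b : mterm X) : mcong rel a b -> meval f a = meval f b.
Proof.
elim=> {a b} //=.
- by move=> a b c _ -> _ ->.
- by move=> a a' b b' _ -> _ ->.
- by move=> a b c; rewrite addrA.
- by move=> a b; rewrite addrC.
- by move=> a; rewrite add0r.
Qed.

Lemma presmon_lift_pi (a : mterm X) :
  presmon_lift f (\pi_(presmon rel) a) = meval f a.
Proof. by apply: meval_cong; exact: presmon_repr. Qed.

Lemma presmon_lift_gen (x : X) : presmon_lift f (mgen rel x) = f x.
Proof. exact: presmon_lift_pi. Qed.

Lemma presmon_lift_morphism : nmod_morphism (presmon_lift (rel := rel) f).
Proof.
split; first exact: presmon_lift_pi.
elim/quotW=> x; elim/quotW=> y.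
by rewrite [_ + _](presmon_addE rel) !presmon_lift_pi.
Qed.

Lemma presmon_lift_unique (g : presmon rel -> M) : nmod_morphism g ->
  (forall x, g (mgen rel x) = f x) -> g =1 presmon_lift f.
Proof.
move=> [g0 gD] gf x; rewrite -[x]reprK presmon_lift_pi.
elim: (repr x) => //= a IHa b IHb.
by rewrite -(presmon_addE rel) -IHa -IHb -gD.
Qed.

End PresentedMonoidLift.

Lemma meval_sum (X : Type) (M : nmodType) (f : X -> M) (I : Type) (s : seq I)
    (F : I -> mterm X) :
  meval f (\big[@MAdd X/MZero]_(i <- s) F i) = \sum_(i <- s) meval f (F i).
Proof. by elim: s => [|i s IHs]; rewrite ?big_nil // !big_cons /= IHs. Qed.

Lemma presmon_pi_sum (X : Type) (rel : mterm X -> mterm X -> Prop) (I : Type)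
    (s : seq I) (F : I -> mterm X) :
  \pi_(presmon rel) (\big[@MAdd X/MZero]_(i <- s) F i)
  = \sum_(i <- s) \pi_(presmon rel) (F i).
Proof.
elim: s => [|i s IHs]; rewrite ?big_nil // !big_cons -IHs.
by rewrite -(presmon_addE rel).
Qed.

HB.mixin Record Lmodule_isNuAlgebra (K : comNzRingType) A of GRing.Lmodule K A :=
  {
    numul : A -> A -> A;
    numulA : associative numul;
    numulDl : left_distributive numul +%R;
    numulDr : right_distributive numul +%R;
    numulZl : forall (c : K) (x y : A), numul (c *: x) y = c *: numul x y;
    numulZr : forall (c : K) (x y : A), numul x (c *: y) = c *: numul x y
  }.

#[short(type="nuAlgType")]
HB.structure Definition NuAlgebra (K : comNzRingType) :=
  {A of Lmodule_isNuAlgebra K A & GRing.Lmodule K A}.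

Notation "x ** y" := (numul x y) (at level 40, left associativity) : ring_scope.

Section NuAlgebraTheory.
Context (K : comNzRingType).

(* Left ideals of a K-algebra are taken to be K-submodules; this is automatic
   for additive left ideals when the algebra has local units. *)
Definition left_ideal (A : nuAlgType K) (I : set A) : Prop :=
  [/\ I 0,
      forall x y, I x -> I y -> I (x + y),
      forall (c : K) x, I x -> I (c *: x)
    & forall a x, I x -> I (a ** x)].

Definition minimal_left_ideal (A : nuAlgType K) (I : set A) : Prop :=
  [/\ left_ideal I,
      I != [set 0]%classic
    & forall J : set A, left_ideal J -> (J `<=` I)%classic ->
        J = [set 0]%classic \/ J = I].

Definition socle (A : nuAlgType K) : set A :=
  [set x | exists s : seq A,
     (forall y, y \in s -> exists I : set A, minimal_left_ideal I /\ I y)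
     /\ x = \sum_(y <- s) y]%classic.

Definition semisimple (A : nuAlgType K) : Prop := @socle A = [set: A]%classic.

Definition nualg_morphism (A B : nuAlgType K) (f : A -> B) : Prop :=
  linear f /\ {morph f : x y / x ** y}.

Definition nualg_isomorphic (A B : nuAlgType K) : Prop :=
  exists f : A -> B, nualg_morphism f /\ bijective f.

End NuAlgebraTheory.

Inductive aterm (K X : Type) : Type :=
  | AZero : aterm K X
  | AAdd : aterm K X -> aterm K X -> aterm K X
  | AOpp : aterm K X -> aterm K X
  | AScale : K -> aterm K X -> aterm K X
  | AMul : aterm K X -> aterm K X -> aterm K X
  | AGen : X -> aterm K X.
Arguments AZero {K X}.
Arguments AGen {K X}.

(* The least congruence containing the relations [rel] and making the quotient
   an associative K-algebra. *)
Inductive acong (K : comNzRingType) (X : Type)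
    (rel : aterm K X -> aterm K X -> Prop) : aterm K X -> aterm K X -> Prop :=
  | acong_rel a b : rel a b -> acong rel a b
  | acong_refl a : acong rel a a
  | acong_sym a b : acong rel a b -> acong rel b a
  | acong_trans a b c : acong rel a b -> acong rel b c -> acong rel a c
  | acong_add a a' b b' :
      acong rel a a' -> acong rel b b' -> acong rel (AAdd a b) (AAdd a' b')
  | acong_opp a a' : acong rel a a' -> acong rel (AOpp a) (AOpp a')
  | acong_scale c a a' : acong rel a a' -> acong rel (AScale c a) (AScale c a')
  | acong_mul a a' b b' :
      acong rel a a' -> acong rel b b' -> acong rel (AMul a b) (AMul a' b')
  | acong_addA a b c : acong rel (AAdd a (AAdd b c)) (AAdd (AAdd a b) c)
  | acong_addC a b : acong rel (AAdd a b) (AAdd b a)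
  | acong_add0 a : acong rel (AAdd AZero a) a
  | acong_addN a : acong rel (AAdd (AOpp a) a) AZero
  | acong_scaleA c d a : acong rel (AScale c (AScale d a)) (AScale (c * d) a)
  | acong_scale1 a : acong rel (AScale 1 a) a
  | acong_scaleDr c a b :
      acong rel (AScale c (AAdd a b)) (AAdd (AScale c a) (AScale c b))
  | acong_scaleDl c d a :
      acong rel (AScale (c + d) a) (AAdd (AScale c a) (AScale d a))
  | acong_mulA a b c : acong rel (AMul a (AMul b c)) (AMul (AMul a b) c)
  | acong_mulDl a b c :
      acong rel (AMul (AAdd a b) c) (AAdd (AMul a c) (AMul b c))
  | acong_mulDr a b c :
      acong rel (AMul a (AAdd b c)) (AAdd (AMul a b) (AMul a c))
  | acong_mulZl c a b : acong rel (AMul (AScale c a) b) (AScale c (AMul a b))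
  | acong_mulZr c a b : acong rel (AMul a (AScale c b)) (AScale c (AMul a b)).

HB.instance Definition _ (K X : Type) := gen_eqMixin (aterm K X).
HB.instance Definition _ (K X : Type) := gen_choiceMixin (aterm K X).

Section PresentedAlgebra.
Context (K : comNzRingType) (X : Type) (rel : aterm K X -> aterm K X -> Prop).

Definition acongb (a b : aterm K X) : bool := `[< acong rel a b >].

Lemma acongb_refl : reflexive acongb.
Proof. by move=> a; apply/asboolP; exact: acong_refl. Qed.

Lemma acongb_sym : symmetric acongb.
Proof. by move=> a b; apply/asboolP/asboolP; exact: acong_sym. Qed.

Lemma acongb_trans : transitive acongb.
Proof.
by move=> b a c /asboolP ab /asboolP bc; apply/asboolP; exact: acong_trans bc.
Qed.

Canonical acong_equiv := EquivRel acongb acongb_refl acongb_sym acongb_trans.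

Definition presalg : Type := {eq_quot acong_equiv}.
HB.instance Definition _ := Choice.on presalg.
HB.instance Definition _ := EqQuotient.on presalg.

Definition agen (x : X) : presalg := \pi_presalg (AGen x).
Definition presalg_zero : presalg := \pi_presalg AZero.
Definition presalg_add : presalg -> presalg -> presalg :=
  lift_op2 presalg (@AAdd K X).
Definition presalg_opp : presalg -> presalg := lift_op1 presalg (@AOpp K X).
Definition presalg_scale (c : K) : presalg -> presalg :=
  lift_op1 presalg (@AScale K X c).
Definition presalg_mul : presalg -> presalg -> presalg :=
  lift_op2 presalg (@AMul K X).

Lemma presalg_piP (a b : aterm K X) :
  acong rel a b <-> \pi_presalg a = \pi_presalg b.
Proof.
by split=> [ab|/eqmodP /asboolP //]; apply/eqmodP/asboolP.
Qed.

Lemma presalg_repr (a : aterm K X) : acong rel (repr (\pi_presalg a)) a.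
Proof. by apply/presalg_piP; rewrite reprK. Qed.

Lemma presalg_addE (a b : aterm K X) :
  presalg_add (\pi_presalg a) (\pi_presalg b) = \pi_presalg (AAdd a b).
Proof. by unlock presalg_add; apply/presalg_piP; apply: acong_add; exact: presalg_repr. Qed.

Lemma presalg_oppE (a : aterm K X) :
  presalg_opp (\pi_presalg a) = \pi_presalg (AOpp a).
Proof. by unlock presalg_opp; apply/presalg_piP; apply: acong_opp; exact: presalg_repr. Qed.

Lemma presalg_scaleE (c : K) (a : aterm K X) :
  presalg_scale c (\pi_presalg a) = \pi_presalg (AScale c a).
Proof. by unlock presalg_scale; apply/presalg_piP; apply: acong_scale; exact: presalg_repr. Qed.

Lemma presalg_mulE (a b : aterm K X) :
  presalg_mul (\pi_presalg a) (\pi_presalg b) = \pi_presalg (AMul a b).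
Proof. by unlock presalg_mul; apply/presalg_piP; apply: acong_mul; exact: presalg_repr. Qed.

Definition presalg_E :=
  (presalg_addE, presalg_oppE, presalg_scaleE, presalg_mulE).

Lemma presalg_addA : associative presalg_add.
Proof.
elim/quotW=> x; elim/quotW=> y; elim/quotW=> z; rewrite !presalg_E.
by apply/presalg_piP; exact: acong_addA.
Qed.

Lemma presalg_addC : commutative presalg_add.
Proof.
elim/quotW=> x; elim/quotW=> y; rewrite !presalg_E.
by apply/presalg_piP; exact: acong_addC.
Qed.

Lemma presalg_add0 : left_id presalg_zero presalg_add.
Proof.
elim/quotW=> x; rewrite presalg_E.
by apply/presalg_piP; exact: acong_add0.
Qed.

Lemma presalg_addN : left_inverse presalg_zero presalg_opp presalg_add.
Proof.
elim/quotW=> x; rewrite !presalg_E.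
by apply/presalg_piP; exact: acong_addN.
Qed.

HB.instance Definition _ := GRing.isZmodule.Build presalg
  presalg_addA presalg_addC presalg_add0 presalg_addN.

Lemma presalg_scaleA (c d : K) (x : presalg) :
  presalg_scale c (presalg_scale d x) = presalg_scale (c * d) x.
Proof.
elim/quotW: x => x; rewrite !presalg_E.
by apply/presalg_piP; exact: acong_scaleA.
Qed.

Lemma presalg_scale1 : left_id 1 presalg_scale.
Proof.
elim/quotW=> x; rewrite !presalg_E.
by apply/presalg_piP; exact: acong_scale1.
Qed.

Lemma presalg_scaleDr : right_distributive presalg_scale presalg_add.
Proof.
move=> c; elim/quotW=> x; elim/quotW=> y; rewrite !presalg_E.
by apply/presalg_piP; exact: acong_scaleDr.
Qed.

Lemma presalg_scaleDl (x : presalg) (c d : K) :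
  presalg_scale (c + d) x = presalg_add (presalg_scale c x) (presalg_scale d x).
Proof.
elim/quotW: x => x; rewrite !presalg_E.
by apply/presalg_piP; exact: acong_scaleDl.
Qed.

HB.instance Definition _ := GRing.Zmodule_isLmodule.Build K presalg
  presalg_scaleA presalg_scale1 presalg_scaleDr presalg_scaleDl.

Lemma presalg_mulA : associative presalg_mul.
Proof.
elim/quotW=> x; elim/quotW=> y; elim/quotW=> z; rewrite !presalg_E.
by apply/presalg_piP; exact: acong_mulA.
Qed.

Lemma presalg_mulDl : left_distributive presalg_mul presalg_add.
Proof.
elim/quotW=> x; elim/quotW=> y; elim/quotW=> z; rewrite !presalg_E.
by apply/presalg_piP; exact: acong_mulDl.
Qed.

Lemma presalg_mulDr : right_distributive presalg_mul presalg_add.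
Proof.
elim/quotW=> x; elim/quotW=> y; elim/quotW=> z; rewrite !presalg_E.
by apply/presalg_piP; exact: acong_mulDr.
Qed.

Lemma presalg_mulZl (c : K) (x y : presalg) :
  presalg_mul (presalg_scale c x) y = presalg_scale c (presalg_mul x y).
Proof.
elim/quotW: x => x; elim/quotW: y => y; rewrite !presalg_E.
by apply/presalg_piP; exact: acong_mulZl.
Qed.

Lemma presalg_mulZr (c : K) (x y : presalg) :
  presalg_mul x (presalg_scale c y) = presalg_scale c (presalg_mul x y).
Proof.
elim/quotW: x => x; elim/quotW: y => y; rewrite !presalg_E.
by apply/presalg_piP; exact: acong_mulZr.
Qed.

HB.instance Definition _ := Lmodule_isNuAlgebra.Build K presalg
  presalg_mulA presalg_mulDl presalg_mulDr presalg_mulZl presalg_mulZr.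

End PresentedAlgebra.

Fixpoint aeval (K : comNzRingType) (X : Type) (A : nuAlgType K) (f : X -> A)
    (a : aterm K X) : A :=
  match a with
  | AZero => 0
  | AAdd a b => aeval f a + aeval f b
  | AOpp a => - aeval f a
  | AScale c a => c *: aeval f a
  | AMul a b => aeval f a ** aeval f b
  | AGen x => f x
  end.

Definition presalg_lift (K : comNzRingType) (X : Type)
  (rel : aterm K X -> aterm K X -> Prop) (A : nuAlgType K) (f : X -> A)
  (x : presalg rel) : A := aeval f (repr x).

Section PresentedAlgebraLift.
Context (K : comNzRingType) (X : Type) (rel : aterm K X -> aterm K X -> Prop).
Context (A : nuAlgType K) (f : X -> A).
Context (f_rel : forall a b, rel a b -> aeval f a = aeval f b).

Lemma aeval_cong (a b : aterm K X) : acong rel a b -> aeval f a = aeval f b.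
Proof.
elim=> {a b} //=.
- by move=> a b c _ -> _ ->.
- by move=> a a' b b' _ -> _ ->.
- by move=> a a' _ ->.
- by move=> c a a' _ ->.
- by move=> a a' b b' _ -> _ ->.
- by move=> a b c; rewrite addrA.
- by move=> a b; rewrite addrC.
- by move=> a; rewrite add0r.
- by move=> a; rewrite addNr.
- by move=> c d a; rewrite scalerA.
- by move=> a; rewrite scale1r.
- by move=> c a b; rewrite scalerDr.
- by move=> c d a; rewrite scalerDl.
- by move=> a b c; rewrite numulA.
- by move=> a b c; rewrite numulDl.
- by move=> a b c; rewrite numulDr.
- by move=> c a b; rewrite numulZl.
- by move=> c a b; rewrite numulZr.
Qed.

Lemma presalg_lift_pi (a : aterm K X) :
  presalg_lift f (\pi_(presalg rel) a) = aeval f a.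
Proof. by apply: aeval_cong; exact: presalg_repr. Qed.

Lemma presalg_lift_gen (x : X) : presalg_lift f (agen rel x) = f x.
Proof. exact: presalg_lift_pi. Qed.

Lemma presalg_lift_morphism : nualg_morphism (presalg_lift (rel := rel) f).
Proof.
split=> [c|]; elim/quotW=> x; elim/quotW=> y.
  rewrite [c *: _](presalg_scaleE rel).
  by rewrite [_ + _](presalg_addE rel) !presalg_lift_pi.
by rewrite [_ ** _](presalg_mulE rel) !presalg_lift_pi.
Qed.

Lemma presalg_lift_unique (g : presalg rel -> A) : nualg_morphism g ->
  (forall x, g (agen rel x) = f x) -> g =1 presalg_lift f.
Proof.
move=> [gL gM] gf x; rewrite -[x]reprK presalg_lift_pi.
have gD y z : g (y + z) = g y + g z by rewrite -[y]scale1r gL !scale1r.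
have g0 : g 0 = 0 by apply: (@addrI _ (g 0)); rewrite -gD !addr0.
have gZ c y : g (c *: y) = c *: g y by rewrite -[_ *: y]addr0 gL g0 addr0.
elim: (repr x) => //=.
- move=> a IHa b IHb.
  by rewrite -(presalg_addE rel) -IHa -IHb -gD.
- move=> a IHa; rewrite -(presalg_oppE rel) -IHa.
  by rewrite -[RHS]scaleN1r -gZ scaleN1r.
- by move=> c a IHa; rewrite -(presalg_scaleE rel) -IHa -gZ.
- move=> a IHa b IHb.
  by rewrite -(presalg_mulE rel) -IHa -IHb -gM.
Qed.

End PresentedAlgebraLift.

(* The i-th standard generator, of N^k for R = nat and of Z^k for R = int. *)
Definition stdgen (R : pzSemiRingType) (k : nat) (i : 'I_k) : {ffun 'I_k -> R} :=
  [ffun j => (i == j)%:R].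

(* A small category presented by its objects, morphisms and identities, with a
   degree functor.  The composite [cmp l m] is meaningful only when
   [src l = rng m]; its other values are unspecified. *)
Record kgraph (k : nat) : Type := KGraph {
  obj : countType;
  mor : countType;
  rng : mor -> obj;
  src : mor -> obj;
  idm : obj -> mor;
  cmp : mor -> mor -> mor;
  deg : mor -> {ffun 'I_k -> nat};
  rng_idm : forall v, rng (idm v) = v;
  src_idm : forall v, src (idm v) = v;
  rng_cmp : forall l m, src l = rng m -> rng (cmp l m) = rng l;
  src_cmp : forall l m, src l = rng m -> src (cmp l m) = src m;
  cmp_idl : forall l, cmp (idm (rng l)) l = l;
  cmp_idr : forall l, cmp l (idm (src l)) = l;
  cmpA : forall l m n, src l = rng m -> src m = rng n ->
    cmp l (cmp m n) = cmp (cmp l m) n;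
  deg_idm : forall v, deg (idm v) = 0;
  deg_cmp : forall l m, src l = rng m -> deg (cmp l m) = deg l + deg m;
  unique_factorization : forall l (m n : {ffun 'I_k -> nat}),
    deg l = m + n ->
    exists! p : mor * mor,
      [/\ src p.1 = rng p.2, l = cmp p.1 p.2, deg p.1 = m & deg p.2 = n]
}.

Section KGraphs.
Context (k : nat) (L : kgraph k).

(* [enumerates s v n]: the finite set v L^n is listed without repetition
   by s. *)
Definition enumerates (s : seq (mor L)) (v : obj L) (n : {ffun 'I_k -> nat})
    : Prop :=
  uniq s /\ (forall l, (l \in s) = (rng l == v) && (deg l == n)).

Definition row_finite : Prop := forall v n, exists s, enumerates s v n.

Definition no_sources : Prop :=
  forall v n, exists l : mor L, rng l = v /\ deg l = n.

(* The generator (v, n) stands for v(n). *)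
Definition tgen : Type := (obj L * {ffun 'I_k -> int})%type.

Inductive talented_rel : mterm tgen -> mterm tgen -> Prop :=
  | TalentedRel (v : obj L) (n : {ffun 'I_k -> int}) (i : 'I_k)
      (s : seq (mor L)) :
      enumerates s v (stdgen nat i) -> s != [::] ->
      talented_rel (MGen (v, n))
        (\big[@MAdd tgen/MZero]_(a <- s) MGen (src a, n + stdgen int i)).

Definition talented : Type := presmon talented_rel.
HB.instance Definition _ := GRing.Nmodule.on talented.

Definition tvertex (v : obj L) (n : {ffun 'I_k -> int}) : talented :=
  mgen talented_rel (v, n).

Definition tshift (n : {ffun 'I_k -> int}) : talented -> talented :=
  presmon_lift (rel := talented_rel) (fun x => tvertex x.1 (x.2 + n)).

Lemma tvertexE (v : obj L) (n : {ffun 'I_k -> int}) (i : 'I_k)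
    (s : seq (mor L)) :
  enumerates s v (stdgen nat i) -> s != [::] ->
  tvertex v n = \sum_(a <- s) tvertex (src a) (n + stdgen int i).
Proof.
move=> es s0; rewrite /tvertex /mgen -presmon_pi_sum.
by apply/presmon_piP/mcong_rel; exact: TalentedRel es s0.
Qed.

Lemma tshift_rel (n : {ffun 'I_k -> int}) (a b : mterm tgen) :
  talented_rel a b ->
  meval (fun x => tvertex x.1 (x.2 + n)) a
  = meval (fun x => tvertex x.1 (x.2 + n)) b.
Proof.
move=> [v m i s es s0] /=; rewrite meval_sum /= (tvertexE _ es s0).
by apply: eq_bigr => l _; rewrite addrAC.
Qed.

Lemma tshift_vertex (n m : {ffun 'I_k -> int}) (v : obj L) :
  tshift n (tvertex v m) = tvertex v (m + n).
Proof. exact: (presmon_lift_gen (tshift_rel n)). Qed.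

HB.instance Definition _ (n : {ffun 'I_k -> int}) :=
  GRing.isNmodMorphism.Build talented talented (tshift n)
    (presmon_lift_morphism (tshift_rel n)).

Lemma talented_ext (M : nmodType) (f g : {additive talented -> M}) :
  (forall v n, f (tvertex v n) = g (tvertex v n)) -> f =1 g.
Proof.
move=> fg x; rewrite -[x]reprK; elim: (repr x) => [|a IHa b IHb|[v n]].
- by rewrite -[\pi _]/(0 : talented) !raddf0.
- by rewrite -(presmon_addE talented_rel) [LHS]raddfD [RHS]raddfD IHa IHb.
- exact: fg.
Qed.

Lemma tshift0 (x : talented) : tshift 0 x = x.
Proof.
by apply: (talented_ext (f := tshift 0) (g := idfun)) => v n;
   rewrite /= tshift_vertex addr0.
Qed.

Lemma tshiftD (m n : {ffun 'I_k -> int}) (x : talented) :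
  tshift (m + n) x = tshift m (tshift n x).
Proof.
apply: (talented_ext (f := tshift (m + n)) (g := tshift m \o tshift n)) => v p.
by rewrite /= !tshift_vertex [m + n]addrC addrA.
Qed.

Definition talented_fin_gen : Prop :=
  exists A : seq talented, forall x : talented,
    exists s : seq ({ffun 'I_k -> int} * talented),
      all (fun p => p.2 \in A) s /\ x = \sum_(p <- s) tshift p.1 p.2.

Definition nzmor : Type := {l : mor L | deg l != 0}.

Inductive kpgen : Type :=
  | KPvertex of obj L
  | KPpath of nzmor
  | KPghost of nzmor.

Section KumjianPask.
Context (K : comNzRingType).

Definition kp_p (v : obj L) : aterm K kpgen := AGen (KPvertex v).

(* s_l and s_{l^*} for all l, with s_v = s_{v^*} = p_v on identities, which are
   exactly the morphisms of degree 0. *)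
Definition kp_s (l : mor L) : aterm K kpgen :=
  if insub l is Some l' then AGen (KPpath l') else kp_p (rng l).
Definition kp_sst (l : mor L) : aterm K kpgen :=
  if insub l is Some l' then AGen (KPghost l') else kp_p (rng l).

Inductive kp_rel : aterm K kpgen -> aterm K kpgen -> Prop :=
  | KP1 u v : kp_rel (AMul (kp_p u) (kp_p v)) (if u == v then kp_p u else AZero)
  | KP2_path l m : deg l != 0 -> deg m != 0 -> src l = rng m ->
      kp_rel (AMul (kp_s l) (kp_s m)) (kp_s (cmp l m))
  | KP2_ghost l m : deg l != 0 -> deg m != 0 -> src l = rng m ->
      kp_rel (AMul (kp_sst m) (kp_sst l)) (kp_sst (cmp l m))
  | KP2_rng_path l : deg l != 0 ->
      kp_rel (AMul (kp_p (rng l)) (kp_s l)) (kp_s l)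
  | KP2_path_src l : deg l != 0 ->
      kp_rel (AMul (kp_s l) (kp_p (src l))) (kp_s l)
  | KP2_src_ghost l : deg l != 0 ->
      kp_rel (AMul (kp_p (src l)) (kp_sst l)) (kp_sst l)
  | KP2_ghost_rng l : deg l != 0 ->
      kp_rel (AMul (kp_sst l) (kp_p (rng l))) (kp_sst l)
  | KP3 l m : deg l != 0 -> deg m != 0 -> deg l = deg m ->
      kp_rel (AMul (kp_sst l) (kp_s m))
        (if l == m then kp_p (src l) else AZero)
  | KP4 v n s : enumerates s v n ->
      kp_rel (kp_p v)
        (\big[@AAdd K kpgen/AZero]_(l <- s) AMul (kp_s l) (kp_sst l)).

Definition KP : Type := presalg kp_rel.
HB.instance Definition _ := NuAlgebra.on KP.

End KumjianPask.
End KGraphs.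

Definition talented_isomorphism (k : nat) (L M : kgraph k)
    (phi : talented L -> talented M) : Prop :=
  [/\ nmod_morphism phi,
      forall n x, phi (tshift n x) = tshift n (phi x)
    & bijective phi].

(* Main.v *)
Require Import Defs.
From mathcomp Require Import all_boot all_order all_algebra.
From mathcomp Require Import boolp classical_sets cardinality.
From mathcomp Require Import zify.

Set Implicit Arguments.
Unset Strict Implicit.
Unset Printing Implicit Defensive.

Import Order.TTheory GRing.Theory Num.Theory.
Local Open Scope ring_scope.
Local Open Scope quotient_scope.

(** The algebra KP(L) is semisimple exactly when every vertex v has a degree at
    which all paths from v have reached aperiodic line vertices: vertices that
    emit one path of each degree and whose infinite path never meets the same
    vertex twice ([ends_in_lines]). This condition is visible in the talented
    monoid: aperiodic line vertices are the elements v(n) that are atoms with a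
    trivial stabiliser ([apline_atom], [atom_apline]), and the condition says
    that every element of the monoid is a sum of such atoms. It is therefore
    invariant under equivariant isomorphism.

    If KP(L) is semisimple, then p_v lies in a sum of r minimal left ideals,
    where chains of left ideals have at most r steps ([chain_length]). The
    orthogonal idempotents s_a s_a^*, for a in v L^n, show that v has at most r
    paths of each degree, so the vertices reached at a degree with the maximal
    number of paths are line vertices. If the line of such a vertex w were
    periodic, then t = s_a s_b^* with d(a) <> d(b), r(a) = r(b) = w and
    s(a) = s(b) would give an infinite strictly decreasing sequence of left
    ideals, generated by the p_w - t^(2^i). Nonvanishing and strictness are
    read off a representation on functions of finite paths, taken modulo
    equality in large degrees ([act_cong]).

    Conversely, let every vertex lead to aperiodic lines. Then KP(L) is spanned
    by the elements s_a s_b^* where s(a) = s(b) is an aperiodic line vertex;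
    such an element depends only on the infinite paths that extend a and b, and
    these elements are matrix units ([path_matrix_units]). Hence KP(L) is a
    direct sum of matrix algebras, one for each shift orbit of aperiodic atoms.
    The index set of each summand is countably infinite, because the vertices
    of an aperiodic line are distinct. Such an algebra is semisimple
    ([mu_semisimple]) and is determined up to isomorphism by the set of orbits
    ([mu_isomorphic]), which the isomorphism of talented monoids preserves. *)

(** * Paths and line vertices *)

Section Paths.
Context (k : nat) (L : kgraph k).
Implicit Types (u v : obj L) (l a b : mor L) (m n : {ffun 'I_k -> nat}).

Lemma factor l m n : deg l = m + n ->
  exists a b, [/\ src a = rng b, l = cmp a b, deg a = m & deg b = n].
Proof.
by move=> /unique_factorization [[a b] [/= h _]]; exists a, b.
Qed.

Lemma cmp_inj a b a' b' : src a = rng b -> src a' = rng b' ->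
  deg a = deg a' -> cmp a b = cmp a' b' -> a = a' /\ b = b'.
Proof.
move=> ab ab' da e.
have db : deg b = deg b'.
  have : deg (cmp a b) = deg (cmp a' b') by rewrite e.
  by rewrite !deg_cmp // da => /ffunP h; apply/ffunP=> i;
     move: (h i); rewrite !ffunE => /addnI.
have [[a0 b0] [_ U]] := unique_factorization (deg_cmp ab).
have e1 : (a0, b0) = (a, b) by apply: U.
have e2 : (a0, b0) = (a', b') by apply: U.
by move: e2; rewrite e1 => -[-> ->].
Qed.

Lemma cmp_injr a b b' : src a = rng b -> src a = rng b' ->
  cmp a b = cmp a b' -> b = b'.
Proof. by move=> h h' e; have [] := cmp_inj h h' erefl e. Qed.

Lemma deg0_idm l : deg l = 0 -> l = idm (rng l).
Proof.
move=> l0; have [] := @cmp_inj l (idm (src l)) (idm (rng l)) l.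
- by rewrite rng_idm.
- by rewrite src_idm.
- by rewrite l0 deg_idm.
- by rewrite cmp_idl cmp_idr.
- by move=> <-.
Qed.

Context (Lrf : row_finite L) (Lns : no_sources L).

(** A list of the paths of degree [n] with range [v]. *)
Definition paths v n : seq (mor L) := sval (cid (Lrf v n)).

Lemma paths_enum v n : enumerates (paths v n) v n.
Proof. by rewrite /paths; case: cid. Qed.

Lemma paths_uniq v n : uniq (paths v n).
Proof. by have [] := paths_enum v n. Qed.

Lemma mem_paths v n l : (l \in paths v n) = (rng l == v) && (deg l == n).
Proof. by have [_ ->] := paths_enum v n. Qed.

Lemma pathsP v n l : reflect (rng l = v /\ deg l = n) (l \in paths v n).
Proof. by rewrite mem_paths; apply: (iffP andP) => -[/eqP ? /eqP ?]. Qed.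

Lemma enum_perm (s s' : seq (mor L)) v n :
  enumerates s v n -> enumerates s' v n -> perm_eq s s'.
Proof.
move=> [us ms] [us' ms']; apply: uniq_perm => // l.
by rewrite ms ms'.
Qed.

Lemma paths_neq0 v n : paths v n != [::].
Proof.
have [l h] := Lns v n; have /pathsP : rng l = v /\ deg l = n by [].
by case: (paths v n).
Qed.

Lemma paths0 v : paths v 0 = [:: idm v].
Proof.
apply/perm_small_eq => //; apply: uniq_perm (paths_uniq _ _) _ _ => // l.
rewrite inE; apply/pathsP/eqP => [[<- /deg0_idm //]|->].
by rewrite rng_idm deg_idm.
Qed.

Lemma pathsD v m n :
  perm_eq (paths v (m + n))
          (flatten [seq [seq cmp a b | b <- paths (src a) n] | a <- paths v m]).
Proof.
apply: uniq_perm; first exact: paths_uniq.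
  rewrite -/(allpairs_dep _ _ _).
  apply: allpairs_uniq_dep => [|a _|]; [exact: paths_uniq | exact: paths_uniq |].
  move=> p p' /allpairsPdep[a [b [/pathsP[ra da] /pathsP[rb db] ->]]].
  move=> /allpairsPdep[a' [b' [/pathsP[ra' da'] /pathsP[rb' db'] ->]]] /= e.
  by have [-> ->] := cmp_inj (esym rb) (esym rb') (etrans da (esym da')) e.
move=> l; apply/pathsP/allpairsPdep => [[rl dl]|].
  have [a [b [ab e da db]]] := factor dl; exists a, b; split => //.
    by apply/pathsP; split=> //; rewrite -rl e rng_cmp.
  by apply/pathsP; split.
move=> [a [b [/pathsP[ra da] /pathsP[rb db] ->]]].
by rewrite rng_cmp // deg_cmp // ra da db.
Qed.

(** A line vertex: no two of its paths have the same degree. As there are no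
    sources, it emits exactly one path of each degree. *)
Definition line v : Prop := forall a b, rng a = v -> rng b = v ->
  deg a = deg b -> a = b.

(** An aperiodic line vertex: moreover, the vertices on its unique infinite
    path are pairwise distinct. *)
Definition apline v : Prop := line v /\
  (forall a b, rng a = v -> rng b = v -> src a = src b -> a = b).

(** The combinatorial form of semisimplicity: every vertex has a degree at
    which all of its paths have reached aperiodic line vertices. *)
Definition ends_in_lines : Prop :=
  forall v, exists n, forall a, rng a = v -> deg a = n -> apline (src a).

Lemma line_src a : line (rng a) -> line (src a).
Proof.
move=> h b c rb rc d; apply: (@cmp_injr a) => //.
by apply: h; rewrite ?rng_cmp ?deg_cmp // d.
Qed.

Lemma apline_src a : apline (rng a) -> apline (src a).
Proof.
move=> [h h']; split; first exact: line_src.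
move=> b c rb rc e; apply: (@cmp_injr a) => //.
by apply: h'; rewrite ?rng_cmp ?src_cmp // e.
Qed.

(** Two paths leaving a line vertex have a common extension. *)
Lemma line_join a b : line (rng a) -> rng a = rng b ->
  exists c d, [/\ src a = rng c, src b = rng d & cmp a c = cmp b d].
Proof.
move=> h e; have [c [rc dc]] := Lns (src a) (deg b).
have [d [rd dd]] := Lns (src b) (deg a).
exists c, d; split=> //; apply: h; rewrite ?rng_cmp //.
by rewrite !deg_cmp // dc dd addrC.
Qed.

Lemma line_paths v n : line v -> exists2 a, rng a = v & paths v n = [:: a].
Proof.
move=> h; case E : (paths v n) (paths_neq0 v n) (paths_uniq v n) => [//|a s] _.
have /pathsP[ra da] : a \in paths v n by rewrite E mem_head.
move=> u; exists a => //; case: s E u => // b s E.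
have /pathsP[rb db] : b \in paths v n by rewrite E !inE eqxx orbT.
by rewrite /= (h _ _ ra rb (etrans da (esym db))) mem_head.
Qed.

End Paths.

(** * Algebras without unit *)

Section NuAlgebraLemmas.
Context (K : comNzRingType) (A : nuAlgType K).
Implicit Types x y : A.

Lemma numul0r x : 0 ** x = 0.
Proof. by rewrite -[X in X ** _](scale0r x) numulZl scale0r. Qed.

Lemma numulr0 x : x ** 0 = 0.
Proof. by rewrite -[X in _ ** X](scale0r x) numulZr scale0r. Qed.

Lemma numul_suml (I : Type) (s : seq I) (F : I -> A) x :
  (\sum_(i <- s) F i) ** x = \sum_(i <- s) F i ** x.
Proof.
elim: s => [|i s IHs]; first by rewrite !big_nil numul0r.
by rewrite !big_cons numulDl IHs.
Qed.

Lemma numul_sumr (I : Type) (s : seq I) (F : I -> A) x :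
  x ** (\sum_(i <- s) F i) = \sum_(i <- s) x ** F i.
Proof.
elim: s => [|i s IHs]; first by rewrite !big_nil numulr0.
by rewrite !big_cons numulDr IHs.
Qed.

Lemma numulrN x y : x ** (- y) = - (x ** y).
Proof. by rewrite -scaleN1r numulZr scaleN1r. Qed.

Lemma numulNr x y : (- x) ** y = - (x ** y).
Proof. by rewrite -scaleN1r numulZl scaleN1r. Qed.

(** The linear span of a set of elements. *)
Inductive lspan (G : A -> Prop) : A -> Prop :=
  | lspan0 : lspan G 0
  | lspanS c g x : G g -> lspan G x -> lspan G (c *: g + x).

Section Span.
Context (G : A -> Prop).

Lemma lspan_gen x : G x -> lspan G x.
Proof. by move=> h; rewrite -[x]addr0 -[x]scale1r; apply/lspanS/lspan0. Qed.

Lemma lspanD x y : lspan G x -> lspan G y -> lspan G (x + y).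
Proof.
move=> + Gy; elim=> [|c g z Gg _ IH]; first by rewrite add0r.
by rewrite -addrA; apply: lspanS.
Qed.

Lemma lspanZ c x : lspan G x -> lspan G (c *: x).
Proof.
elim=> [|d g z Gg _ IH]; first by rewrite scaler0; apply: lspan0.
by rewrite scalerDr scalerA; apply: lspanS.
Qed.

Lemma lspan_sum (I : Type) (s : seq I) (P : pred I) (F : I -> A) :
  (forall i, P i -> lspan G (F i)) -> lspan G (\sum_(i <- s | P i) F i).
Proof. by move=> h; apply: big_ind => //; [apply: lspan0|apply: lspanD]. Qed.

Lemma lspan_trans (G' : A -> Prop) x : (forall g, G' g -> lspan G g) ->
  lspan G' x -> lspan G x.
Proof.
move=> h; elim=> [|c g z Gg _ IH]; first exact: lspan0.
by apply: lspanD => //; apply/lspanZ/h.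
Qed.

Lemma lspanM : (forall g h, G g -> G h -> lspan G (g ** h)) ->
  forall x y, lspan G x -> lspan G y -> lspan G (x ** y).
Proof.
move=> H x y + Gy; elim=> [|c g z Gg _ IH]; first by rewrite numul0r; apply: lspan0.
rewrite numulDl numulZl; apply: lspanD => //; apply: lspanZ.
elim: Gy => [|d h w Gh _ IHw]; first by rewrite numulr0; apply: lspan0.
by rewrite numulDr numulZr; apply: lspanD => //; apply/lspanZ/H.
Qed.

End Span.

End NuAlgebraLemmas.

(** * The Kumjian-Pask algebra is spanned by the elements s_a s_b^* *)

Section KPBasics.
Context (k : nat) (L : kgraph k) (K : comNzRingType).
Implicit Types (u v : obj L) (l a b : mor L) (m n : {ffun 'I_k -> nat}).

Local Notation A := (KP L K).
(** The class of a term. *)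
Definition kpi (t : aterm K (kpgen L)) : A := \pi_(presalg (@kp_rel k L K)) t.

Lemma kpi_eq t t' : acong (@kp_rel k L K) t t' <-> kpi t = kpi t'.
Proof. exact: presalg_piP. Qed.

Lemma kpi_add t t' : kpi (AAdd t t') = kpi t + kpi t'.
Proof. by rewrite [RHS](presalg_addE (@kp_rel k L K)). Qed.

Lemma kpi_opp t : kpi (AOpp t) = - kpi t.
Proof. by rewrite [RHS](presalg_oppE (@kp_rel k L K)). Qed.

Lemma kpi_scale c t : kpi (AScale c t) = c *: kpi t.
Proof. by rewrite [RHS](presalg_scaleE (@kp_rel k L K)). Qed.

Lemma kpi_mul t t' : kpi (AMul t t') = kpi t ** kpi t'.
Proof. by rewrite [RHS](presalg_mulE (@kp_rel k L K)). Qed.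

Lemma kpi_sum (I : Type) (s : seq I) (F : I -> aterm K (kpgen L)) :
  kpi (\big[@AAdd K (kpgen L)/AZero]_(i <- s) F i) = \sum_(i <- s) kpi (F i).
Proof. by elim: s => [|i s IHs]; rewrite ?big_nil // !big_cons kpi_add IHs. Qed.

Lemma kpi_repr (x : A) : exists t, x = kpi t.
Proof. by exists (repr x); rewrite /kpi reprK. Qed.

(** [kS l] is s_l, [kG l] is the ghost s_{l^*} and [kV v] is p_v; on the
    identity of [v], [kS] and [kG] are both p_v. The relations (KP2) and (KP3)
    are extended below to paths of degree zero. *)
Definition kS l : A := kpi (kp_s K l).
Definition kG l : A := kpi (kp_sst K l).
Definition kV v : A := kpi (kp_p K v).

Lemma kp_rel_eq t t' : kp_rel t t' -> kpi t = kpi t'.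
Proof. by move=> h; apply/kpi_eq/acong_rel. Qed.

Lemma kp_s_deg0 l : deg l = 0 -> kp_s K l = kp_p K (rng l).
Proof. by move=> h; rewrite /kp_s insubF // h eqxx. Qed.

Lemma kp_sst_deg0 l : deg l = 0 -> kp_sst K l = kp_p K (rng l).
Proof. by move=> h; rewrite /kp_sst insubF // h eqxx. Qed.

Lemma kS_deg0 l : deg l = 0 -> kS l = kV (rng l).
Proof. by move=> h; rewrite /kS kp_s_deg0. Qed.

Lemma kG_deg0 l : deg l = 0 -> kG l = kV (rng l).
Proof. by move=> h; rewrite /kG kp_sst_deg0. Qed.

Lemma kV_mul u v : kV u ** kV v = if u == v then kV u else 0.
Proof. by rewrite -kpi_mul (kp_rel_eq (KP1 _ _ _)); case: ifP. Qed.

Lemma src_deg0 l : deg l = 0 -> src l = rng l.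
Proof. by move=> /deg0_idm {1}->; rewrite src_idm. Qed.

Lemma kV_kS l : kV (rng l) ** kS l = kS l.
Proof.
have [h|h] := eqVneq (deg l) 0; first by rewrite kS_deg0 // kV_mul eqxx.
by rewrite -kpi_mul (kp_rel_eq (KP2_rng_path _ h)).
Qed.

Lemma kS_kV l : kS l ** kV (src l) = kS l.
Proof.
have [h|h] := eqVneq (deg l) 0.
  by rewrite kS_deg0 // src_deg0 // kV_mul eqxx.
by rewrite -kpi_mul (kp_rel_eq (KP2_path_src _ h)).
Qed.

Lemma kV_kG l : kV (src l) ** kG l = kG l.
Proof.
have [h|h] := eqVneq (deg l) 0.
  by rewrite kG_deg0 // src_deg0 // kV_mul eqxx.
by rewrite -kpi_mul (kp_rel_eq (KP2_src_ghost _ h)).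
Qed.

Lemma kG_kV l : kG l ** kV (rng l) = kG l.
Proof.
have [h|h] := eqVneq (deg l) 0; first by rewrite kG_deg0 // kV_mul eqxx.
by rewrite -kpi_mul (kp_rel_eq (KP2_ghost_rng _ h)).
Qed.

Lemma kS_mul a b : src a = rng b -> kS a ** kS b = kS (cmp a b).
Proof.
move=> ab; have [ha|ha] := eqVneq (deg a) 0.
  have e := src_deg0 ha; rewrite kS_deg0 // -e ab kV_kS.
  by rewrite (deg0_idm ha) -e ab cmp_idl.
have [hb|hb] := eqVneq (deg b) 0.
  by rewrite (kS_deg0 hb) -ab kS_kV (deg0_idm hb) -ab cmp_idr.
by rewrite -kpi_mul (kp_rel_eq (KP2_path _ ha hb ab)).
Qed.

Lemma kG_mul a b : src a = rng b -> kG b ** kG a = kG (cmp a b).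
Proof.
move=> ab; have [ha|ha] := eqVneq (deg a) 0.
  have e := src_deg0 ha; rewrite (kG_deg0 ha) -e ab kG_kV.
  by rewrite (deg0_idm ha) -e ab cmp_idl.
have [hb|hb] := eqVneq (deg b) 0.
  by rewrite (kG_deg0 hb) -ab kV_kG (deg0_idm hb) -ab cmp_idr.
by rewrite -kpi_mul (kp_rel_eq (KP2_ghost _ ha hb ab)).
Qed.

Lemma kG_kS a b : deg a = deg b ->
  kG a ** kS b = if a == b then kV (src a) else 0.
Proof.
move=> e; have [ha|ha] := eqVneq (deg a) 0.
  have hb : deg b = 0 by rewrite -e.
  rewrite kG_deg0 // kS_deg0 // kV_mul src_deg0 //.
  case: (eqVneq a b) => [->|ab]; first by rewrite eqxx.
  case: eqP => // rab; case/eqP: ab.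
  by rewrite (deg0_idm ha) (deg0_idm hb) rab.
have hb : deg b != 0 by rewrite -e.
by rewrite -kpi_mul (kp_rel_eq (KP3 _ ha hb e)); case: ifP.
Qed.

Lemma kG_kS_id a : kG a ** kS a = kV (src a).
Proof. by rewrite kG_kS // eqxx. Qed.

Context (Lrf : row_finite L).
Local Notation paths := (paths Lrf).

Lemma kV_sum v n : kV v = \sum_(a <- paths v n) kS a ** kG a.
Proof.
rewrite /kV (kp_rel_eq (KP4 _ (paths_enum Lrf v n))) kpi_sum.
by apply: eq_bigr => a _; rewrite kpi_mul.
Qed.

(** Refinement of s_a s_b^* to the extensions of [a] and [b] by degree [n]. *)
Lemma kSG_expand a b n : src a = src b ->
  kS a ** kG b = \sum_(c <- paths (src a) n) kS (cmp a c) ** kG (cmp b c).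
Proof.
move=> e; rewrite -{1}(kS_kV a) (kV_sum _ n) numul_sumr numul_suml.
rewrite !big_seq; apply: eq_bigr => c /pathsP[rc _].
by rewrite -kS_mul // -kG_mul -?e // !numulA.
Qed.

(** The product of a ghost and a path, over the common extensions of degree
    d(a) + d(b). *)
Lemma kG_kS_expand a b : kG a ** kS b =
  \sum_(c <- paths (src a) (deg b)) \sum_(d <- paths (src b) (deg a))
    if cmp a c == cmp b d then kS c ** kG d else 0.
Proof.
rewrite -(kV_kG a) (kV_sum _ (deg b)) -(kS_kV b) (kV_sum (src b) (deg a)).
rewrite !numul_suml big_seq [RHS]big_seq; apply: eq_bigr => c /pathsP[rc dc].
rewrite !numul_sumr big_seq [RHS]big_seq; apply: eq_bigr => d /pathsP[rd dd].
have -> : kS c ** kG c ** kG a ** (kS b ** (kS d ** kG d))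
   = kS c ** ((kG c ** kG a) ** (kS b ** kS d)) ** kG d by rewrite !numulA.
rewrite kG_mul // kS_mul // kG_kS; last by rewrite !deg_cmp // dc dd addrC.
case: ifP => _; last by rewrite numulr0 numul0r.
by rewrite src_cmp // kS_kV.
Qed.

(** The spanning set: the elements s_a s_b^* with s(a) = s(b). *)
Definition kSG (x : A) : Prop :=
  exists a b, src a = src b /\ x = kS a ** kG b.

Lemma kSG_mul x y : kSG x -> kSG y -> lspan kSG (x ** y).
Proof.
move=> [a [b [ab ->]]] [c [d [cd ->]]].
have -> : (kS a ** kG b) ** (kS c ** kG d) = kS a ** (kG b ** kS c) ** kG d.
  by rewrite !numulA.
rewrite kG_kS_expand numul_sumr numul_suml big_seq.
apply: lspan_sum => x' /pathsP[rx dx].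
rewrite numul_sumr numul_suml big_seq.
apply: lspan_sum => y' /pathsP[ry dy].
case: ifP => [/eqP e|_]; last by rewrite numulr0 numul0r; apply: lspan0.
apply: lspan_gen; exists (cmp a x'), (cmp d y'); split.
  by rewrite !src_cmp ?rx ?ry // -(@src_cmp _ _ b) // e src_cmp.
by rewrite -kS_mul ?rx // -kG_mul ?ry // !numulA.
Qed.

Lemma kp_span x : lspan kSG x.
Proof.
have gen a b : src a = src b -> lspan kSG (kS a ** kG b).
  by move=> e; apply: lspan_gen; exists a, b.
have [t ->] := kpi_repr x.
elim: t => [|t IH t' IH'|t IH|c t IH|t IH t' IH'|[v|l|l]].
- exact: lspan0.
- by rewrite kpi_add; apply: lspanD.
- by rewrite kpi_opp -scaleN1r; apply: lspanZ.
- by rewrite kpi_scale; apply: lspanZ.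
- by rewrite kpi_mul; apply: lspanM IH IH'; exact: kSG_mul.
- have -> : kpi (AGen (KPvertex v)) = kS (idm v) ** kG (idm v).
    by rewrite kS_deg0 ?kG_deg0 ?deg_idm // rng_idm kV_mul eqxx.
  exact: gen.
- have -> : kpi (AGen (KPpath l)) = kS (val l) ** kG (idm (src (val l))).
    rewrite kG_deg0 ?deg_idm // rng_idm kS_kV /kS /kp_s.
    by case: insubP => [u _ /val_inj ->|] //; rewrite (valP l).
  by apply: gen; rewrite src_idm.
- have -> : kpi (AGen (KPghost l)) = kS (idm (src (val l))) ** kG (val l).
    rewrite kS_deg0 ?deg_idm // rng_idm kV_kG /kG /kp_sst.
    by case: insubP => [u _ /val_inj ->|] //; rewrite (valP l).
  by apply: gen; rewrite src_idm.
Qed.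

End KPBasics.

(** * The representation on functions of finite paths *)

Section PathRepresentation.
Context (k : nat) (L : kgraph k) (K : comNzRingType).
Implicit Types (u v : obj L) (l m a b : mor L) (n : {ffun 'I_k -> nat}).
Implicit Types (f g : mor L -> K) (t : aterm K (kpgen L)).

(** The path [b] with [m = l b], if [l] is an initial segment of [m]. *)
Definition tail (l m : mor L) : option (mor L) :=
  if pselect (exists b, src l = rng b /\ m = cmp l b) is left h
  then Some (sval (cid h)) else None.

Lemma tail_cmp l b : src l = rng b -> tail l (cmp l b) = Some b.
Proof.
move=> lb; rewrite /tail; case: pselect => [h|]; last by case; exists b.
case: cid => b' /= [lb' /esym e]; congr Some.
exact: cmp_injr e.
Qed.

Lemma tailP l m : (exists b, [/\ src l = rng b, m = cmp l b & tail l m = Some b])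
  \/ ((forall b, src l = rng b -> m <> cmp l b) /\ tail l m = None).
Proof.
rewrite /tail; case: pselect => [h|h]; last first.
  by right; split => // b lb e; apply: h; exists b.
by left; case: cid => b [lb e] /=; exists b.
Qed.

(** The action of s_l, of s_{l^*} and of p_v on a function [f]. *)
Definition act_path l f : mor L -> K :=
  fun m => if tail l m is Some b then f b else 0.
Definition act_ghost l f : mor L -> K :=
  fun b => if src l == rng b then f (cmp l b) else 0.
Definition act_vertex v f : mor L -> K :=
  fun m => if rng m == v then f m else 0.

Definition act_gen (x : kpgen L) : (mor L -> K) -> mor L -> K :=
  match x with
  | KPvertex v => act_vertex v
  | KPpath l => act_path (val l)
  | KPghost l => act_ghost (val l)
  end.

(** Terms act on the functions on finite paths. The relation (KP4) holds only
    for paths of large degree, so the algebra acts on the functions modulo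
    [eveq]: these stand for the functions on infinite paths, but they also
    remember degrees, so that no grading is needed. *)
Fixpoint act t f : mor L -> K :=
  match t with
  | AZero => fun _ => 0
  | AAdd t t' => fun m => act t f m + act t' f m
  | AOpp t => fun m => - act t f m
  | AScale c t => fun m => c * act t f m
  | AMul t t' => act t (act t' f)
  | AGen x => act_gen x f
  end.

(** Equality on all paths of sufficiently large degree. *)
Definition eveq f g : Prop := exists n : {ffun 'I_k -> nat},
  forall m, (forall i, (n i <= deg m i)%N) -> f m = g m.

Lemma eveq_refl f : eveq f f.
Proof. by exists 0. Qed.

Lemma eveq_sym f g : eveq f g -> eveq g f.
Proof. by move=> [n h]; exists n => m hm; rewrite h. Qed.

Lemma eveq2 (f g f' g' h h' : mor L -> K) : eveq f g -> eveq f' g' ->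
  (forall m, f m = g m -> f' m = g' m -> h m = h' m) -> eveq h h'.
Proof.
move=> [n e] [n' e'] H; exists (n + n') => m hm.
apply: H; [apply: e|apply: e'] => i; have := hm i; rewrite ffunE.
  by apply: leq_trans; apply: leq_addr.
by apply: leq_trans; apply: leq_addl.
Qed.

Lemma eveq_trans g f h : eveq f g -> eveq g h -> eveq f h.
Proof. by move=> e e'; apply: (eveq2 e e') => m -> ->. Qed.

Lemma act_path_eveq l f g : eveq f g -> eveq (act_path l f) (act_path l g).
Proof.
move=> [n h]; exists (n + deg l) => m hm; rewrite /act_path.
case: (tailP l m) => [[b [lb e ->]]|[_ -> //]].
by apply: h => i; have := hm i; rewrite e deg_cmp // !ffunE addrC leq_add2l.
Qed.

Lemma act_ghost_eveq l f g : eveq f g -> eveq (act_ghost l f) (act_ghost l g).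
Proof.
move=> [n h]; exists n => m hm; rewrite /act_ghost; case: eqP => // lm.
by apply: h => i; rewrite deg_cmp // ffunE (leq_trans (hm i)) // leq_addl.
Qed.

Lemma act_vertex_eveq v f g : eveq f g -> eveq (act_vertex v f) (act_vertex v g).
Proof. by move=> [n h]; exists n => m hm; rewrite /act_vertex h. Qed.

Lemma act_eveq t f g : eveq f g -> eveq (act t f) (act t g).
Proof.
elim: t f g => [|t IH t' IH'|t IH|c t IH|t IH t' IH'|[v|l|l]] f g fg /=.
- exact: eveq_refl.
- by apply: (eveq2 (IH _ _ fg) (IH' _ _ fg)) => m -> ->.
- by apply: (eveq2 (IH _ _ fg) (IH _ _ fg)) => m ->.
- by apply: (eveq2 (IH _ _ fg) (IH _ _ fg)) => m ->.
- by apply/IH/IH'.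
- exact: act_vertex_eveq.
- exact: act_path_eveq.
- exact: act_ghost_eveq.
Qed.

Lemma act_linear t c f g :
  act t (fun m => c * f m + g m) = (fun m => c * act t f m + act t g m).
Proof.
elim: t f g => [|t IH t' IH'|t IH|d t IH|t IH t' IH'|[v|l|l]] f g /=; apply/funext => m.
- by rewrite mulr0 addr0.
- by rewrite IH IH' mulrDr addrACA.
- by rewrite IH opprD mulrN.
- by rewrite IH mulrDr mulrCA.
- by rewrite IH' IH.
- by rewrite /act_vertex; case: ifP; rewrite ?mulr0 ?addr0.
- by rewrite /act_path; case: tail; rewrite ?mulr0 ?addr0.
- by rewrite /act_ghost; case: ifP; rewrite ?mulr0 ?addr0.
Qed.

Lemma act_add t f g : act t (fun m => f m + g m) = (fun m => act t f m + act t g m).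
Proof.
have := act_linear t 1 f g.
under eq_fun do rewrite mul1r.
by move=> ->; apply/funext => m; rewrite mul1r.
Qed.

Lemma act0 t : act t (fun=> 0) = (fun=> 0).
Proof.
have e := act_linear t (-1) (fun=> 0) (fun=> 0).
have h : (fun m : mor L => -1 * 0 + 0 : K) = (fun=> 0).
  by apply/funext => m; rewrite mulr0 addr0.
by rewrite h in e; apply/funext => m; rewrite {1}e mulN1r addNr.
Qed.

Lemma act_scale t c f : act t (fun m => c * f m) = (fun m => c * act t f m).
Proof.
have := act_linear t c f (fun=> 0).
under eq_fun do rewrite addr0.
by rewrite act0 => ->; apply/funext => m; rewrite addr0.
Qed.

Lemma act_kp_s l : act (kp_s K l) = act_path l.
Proof.
have [h|h] := eqVneq (deg l) 0; last first.
  by rewrite /kp_s; case: insubP => [u _ /= <-|] //; rewrite h.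
rewrite kp_s_deg0 //; apply/funext => f; apply/funext => m /=.
rewrite /act_vertex /act_path (deg0_idm h) rng_idm.
case: eqP => [<-|rm].
  by rewrite -{3}(cmp_idl m) tail_cmp // src_idm.
case: (tailP (idm (rng l)) m) => [[b [lb e ->]]|[_ -> //]].
by case: rm; rewrite e rng_cmp // rng_idm.
Qed.

Lemma act_kp_sst l : act (kp_sst K l) = act_ghost l.
Proof.
have [h|h] := eqVneq (deg l) 0; last first.
  by rewrite /kp_sst; case: insubP => [u _ /= <-|] //; rewrite h.
rewrite kp_sst_deg0 //; apply/funext => f; apply/funext => m /=.
rewrite /act_vertex /act_ghost (deg0_idm h) src_idm rng_idm eq_sym.
by case: eqP => // ->; rewrite cmp_idl.
Qed.

Lemma act_sum (s : seq (mor L)) F f m :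
  act (\big[@AAdd K (kpgen L)/AZero]_(l <- s) F l) f m = \sum_(l <- s) act (F l) f m.
Proof. by elim: s => [|l s IHs]; rewrite ?big_nil // !big_cons /= IHs. Qed.

Lemma act_rel t t' f : kp_rel t t' -> eveq (act t f) (act t' f).
Proof.
case=> {t t'}.
- move=> u v; exists 0 => m _; case: (eqVneq u v) => [<-|uv] /=.
    by rewrite /act_vertex; case: (rng m == u).
  by rewrite /act_vertex; case: eqP => // ->; rewrite (negbTE uv).
- move=> l m _ _ lm; exists 0 => p _; rewrite /= !act_kp_s /act_path.
  case: (tailP (cmp l m) p) => [[b [lb e ->]]|[H ->]].
    rewrite src_cmp // in lb; rewrite e -cmpA // tail_cmp ?rng_cmp //.
    by rewrite tail_cmp.
  case: (tailP l p) => [[b [lb e ->]]|[_ -> //]].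
  case: (tailP m b) => [[c [mc e' _]]|[_ -> //]].
  by case: (H c); rewrite ?src_cmp // e e' cmpA.
- move=> l m _ _ lm; exists 0 => p _; rewrite /= !act_kp_sst /act_ghost.
  rewrite src_cmp //; case: eqP => // mp.
  by rewrite rng_cmp // lm eqxx cmpA.
- move=> l _; exists 0 => m _; rewrite /= act_kp_s /act_vertex /act_path.
  case: (tailP l m) => [[b [lb e ->]]|[_ ->]]; last by rewrite if_same.
  by rewrite e rng_cmp // eqxx.
- move=> l _; exists 0 => m _; rewrite /= act_kp_s /act_vertex /act_path.
  case: (tailP l m) => [[b [lb e ->]]|[_ -> //]].
  by rewrite lb eqxx.
- move=> l _; exists 0 => m _; rewrite /= act_kp_sst /act_vertex /act_ghost.
  by rewrite eq_sym; case: eqP.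
- move=> l _; exists 0 => m _; rewrite /= act_kp_sst /act_vertex /act_ghost.
  by case: eqP => // lm; rewrite rng_cmp // eqxx.
- move=> l m _ _ lm; exists 0 => p _; rewrite /= act_kp_sst act_kp_s.
  rewrite /act_ghost /act_path; case: (eqVneq l m) => [<-|ne].
    rewrite /= /act_vertex eq_sym; case: eqP => // lp.
    by rewrite tail_cmp.
  rewrite /=; case: eqP => // lp.
  case: (tailP m (cmp l p)) => [[b [mb e _]]|[_ -> //]].
  by have [E _] := cmp_inj lp mb lm e; rewrite E eqxx in ne.
- move=> v n s [us ms]; exists n => m hm; rewrite /= act_sum.
  have eF l : act (AMul (kp_s K l) (kp_sst K l)) f m
      = if tail l m is Some _ then f m else 0.
    rewrite /= act_kp_s act_kp_sst /act_path /act_ghost.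
    by case: (tailP l m) => [[b [lb e ->]]|[_ -> //]]; rewrite lb eqxx e.
  under eq_bigr => l _ do rewrite eF.
  have [a [b [ab e da db]]] : exists a b, [/\ src a = rng b, m = cmp a b,
      deg a = n & deg b = [ffun i => deg m i - n i]%N].
    by apply: factor; apply/ffunP => i; rewrite !ffunE -[LHS](subnKC (hm i)).
  rewrite /act_vertex; case: eqP => [rm|rm].
    have as_ : a \in s by rewrite ms da eqxx -rm e rng_cmp // eqxx.
    rewrite (bigD1_seq a) //= big_seq_cond big1 => [|l /andP[ls la]].
      by rewrite e tail_cmp // addr0.
    case: (tailP l m) => [[c [lc e' _]]|[_ -> //]].
    move: ls; rewrite ms => /andP[_ /eqP dl].
    have [E _] := cmp_inj ab lc (etrans da (esym dl)) (etrans (esym e) e').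
    by rewrite E eqxx in la.
  rewrite big_seq big1 // => l ls.
  case: (tailP l m) => [[c [lc e' _]]|[_ -> //]].
  move: ls; rewrite ms => /andP[/eqP rl _].
  by case: rm; rewrite e' rng_cmp.
Qed.

(** The action of a term modulo [eveq] depends only on its class. *)
Lemma act_cong t t' f g :
  acong (@kp_rel k L K) t t' -> eveq f g -> eveq (act t f) (act t' g).
Proof.
move=> tt' fg.
suff : eveq (act t f) (act t' f) by move=> e; apply: eveq_trans e (act_eveq _ fg).
move=> {g fg}.
elim: tt' f => {t t'}.
- by move=> t t' h f; apply: act_rel.
- by move=> t f; apply: eveq_refl.
- by move=> t t' _ IH f; apply/eveq_sym/IH.
- by move=> t t' t'' _ IH _ IH' f; apply: eveq_trans (IH f) (IH' f).
- by move=> a a' b b' _ IH _ IH' f; apply: (eveq2 (IH f) (IH' f)) => m /= -> ->.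
- by move=> a a' _ IH f; apply: (eveq2 (IH f) (IH f)) => m /= ->.
- by move=> c a a' _ IH f; apply: (eveq2 (IH f) (IH f)) => m /= ->.
- by move=> a a' b b' _ IH _ IH' f /=; apply: eveq_trans (IH _) (act_eveq _ (IH' _)).
- by move=> a b c f; exists 0 => m _ /=; rewrite addrA.
- by move=> a b f; exists 0 => m _ /=; rewrite addrC.
- by move=> a f; exists 0 => m _ /=; rewrite add0r.
- by move=> a f; exists 0 => m _ /=; rewrite addNr.
- by move=> c d a f; exists 0 => m _ /=; rewrite mulrA.
- by move=> a f; exists 0 => m _ /=; rewrite mul1r.
- by move=> c a b f; exists 0 => m _ /=; rewrite mulrDr.
- by move=> c d a f; exists 0 => m _ /=; rewrite mulrDl.
- by move=> a b c f; apply: eveq_refl.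
- by move=> a b c f; apply: eveq_refl.
- by move=> a b c f /=; rewrite act_add; apply: eveq_refl.
- by move=> c a b f; apply: eveq_refl.
- by move=> c a b f /=; rewrite act_scale; apply: eveq_refl.
Qed.

Lemma kpi_act t t' f : kpi t = kpi t' -> eveq (act t f) (act t' f).
Proof. by move=> /kpi_eq h; apply: act_cong h (eveq_refl f). Qed.

Context (Lns : no_sources L).

(** The element s_a s_a^* does not kill the constant function 1. *)
Lemma kSG_neq0 a : kS K a ** kG K a != 0.
Proof.
apply/eqP; rewrite -kpi_mul -[0]/(kpi AZero) => /(kpi_act (fun=> 1)) [n h].
have [b [rb db]] := Lns (src a) n.
have := h (cmp a b); rewrite /= act_kp_s act_kp_sst /act_path tail_cmp //.
rewrite /act_ghost rb eqxx => e.
suff /e/eqP : forall i, (n i <= deg (cmp a b) i)%N by rewrite oner_eq0.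
by move=> i; rewrite deg_cmp // db !ffunE leq_addl.
Qed.

End PathRepresentation.

(** * Chains of left ideals in a finite sum of minimal left ideals *)

Section Chains.
Context (K : comNzRingType) (A : nuAlgType K).
Implicit Types (I J M : set A) (s : seq (set A)).

Lemma left_idealN I x : left_ideal I -> I x -> I (- x).
Proof. by move=> [_ _ h _] Ix; rewrite -scaleN1r; apply: h. Qed.

Lemma left_idealB I x y : left_ideal I -> I x -> I y -> I (x - y).
Proof. by move=> h Ix Iy; have [_ D _ _] := h; apply: D => //; apply: left_idealN. Qed.

(** The sum of two left ideals, and of a list of left ideals. *)
Definition addI I J : set A := [set z | exists x y, [/\ I x, J y & z = x + y]].
Definition sumI s : set A := foldr addI [set 0]%classic s.

Lemma left_ideal0 : left_ideal ([set 0]%classic : set A).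
Proof.
split=> [//|x y -> ->|c x ->|a x ->]; first exact: addr0.
  exact: scaler0.
exact: numulr0.
Qed.

Lemma left_ideal_add I J : left_ideal I -> left_ideal J -> left_ideal (addI I J).
Proof.
move=> [I0 ID IZ IM] [J0 JD JZ JM]; split.
- by exists 0, 0; rewrite addr0.
- move=> _ _ [x [y [Ix Jy ->]]] [x' [y' [Ix' Jy' ->]]].
  by exists (x + x'), (y + y'); split; [apply: ID|apply: JD|rewrite addrACA].
- move=> c _ [x [y [Ix Jy ->]]].
  by exists (c *: x), (c *: y); split; [apply: IZ|apply: JZ|rewrite scalerDr].
- move=> a _ [x [y [Ix Jy ->]]].
  by exists (a ** x), (a ** y); split; [apply: IM|apply: JM|rewrite numulDr].
Qed.

Lemma left_idealI I J : left_ideal I -> left_ideal J -> left_ideal (I `&` J)%classic.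
Proof.
move=> [I0 ID IZ IM] [J0 JD JZ JM]; split => //.
- by move=> x y [? ?] [? ?]; split; [apply: ID|apply: JD].
- by move=> c x [? ?]; split; [apply: IZ|apply: JZ].
- by move=> a x [? ?]; split; [apply: IM|apply: JM].
Qed.

Lemma left_ideal_sum s : (forall I, List.In I s -> minimal_left_ideal I) ->
  left_ideal (sumI s).
Proof.
elim: s => [|I s IHs] h; first exact: left_ideal0.
apply: left_ideal_add; last by apply: IHs => J Js; apply: h; right.
by case: (h I) => //; left.
Qed.

(** A monotone sequence of booleans switches at most once. *)
Lemma sum_switch (b : nat -> bool) n : (forall i, b i -> b i.+1) ->
  (\sum_(i < n) (~~ b i && b i.+1) <= b n)%N.
Proof.
move=> h; elim: n => [|n IHn]; first by rewrite big_ord0.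
rewrite big_ord_recr /=; have := h n; move: IHn.
by case: (b n); case: (b n.+1) => //=; lia.
Qed.

(** A sum of [size s] minimal left ideals has length at most [size s]: an
    increasing chain [J] in [I + M] is determined by its intersection with [M]
    and its sum with [M], and the latter changes at most once when [I] is
    minimal. *)
Lemma chain_length s (J : nat -> set A) n :
  (forall I, List.In I s -> minimal_left_ideal I) ->
  (forall i, left_ideal (J i)) -> (forall i, (J i `<=` J i.+1)%classic) ->
  (forall i, (J i `<=` sumI s)%classic) ->
  (\sum_(i < n) `[< J i <> J i.+1 >] <= size s)%N.
Proof.
elim: s J => [|I s IHs] J mins idJ incJ subJ.
  rewrite big1 // => i _; apply/eqP; rewrite eqb0; apply/asboolPn; apply.
  suff E j : J j = [set 0]%classic by rewrite !E.
  by apply/seteqP; split=> [x /subJ //|x ->]; have [] := idJ j.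
have minI : minimal_left_ideal I by apply: mins; left.
have {}mins J' : List.In J' s -> minimal_left_ideal J' by move=> h; apply: mins; right.
have idM := left_ideal_sum mins.
pose J' i := (J i `&` sumI s)%classic.
pose b i := `[< (I `<=` addI (J i) (sumI s))%classic >].
have hJ' : (\sum_(i < n) `[< J' i <> J' i.+1 >] <= size s)%N.
  apply: IHs => // i.
  - exact: left_idealI.
  - by move=> x [Jx Mx]; split=> //; apply: incJ.
  - by move=> x [].
have hb : (\sum_(i < n) (~~ b i && b i.+1) <= 1)%N.
  apply: leq_trans (sum_switch _ _) (leq_b1 _) => i /asboolP bi; apply/asboolP.
  by move=> x /bi [y [z [Jy Mz ->]]]; exists y, z; split => //; apply: incJ.
apply: leq_trans (leq_add hb hJ'); rewrite -big_split /=.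
apply: leq_sum => i _; case: asboolP => //= neJ.
suff : ~~ b i && b i.+1 \/ J' i <> J' i.+1.
  case=> [->|h]; first by rewrite leq_addr.
  by case: (asboolP (J' i <> J' i.+1)) => //= _; rewrite leq_addl.
case: (pselect (J' i = J' i.+1)) => [eJ'|]; last by right.
left; apply/negPn/negP; rewrite negb_and negbK => hbi.
apply: neJ; apply/seteqP; split=> [|x Jx]; first exact: incJ.
have subJ' y : J i.+1 y -> sumI s y -> J i y.
  by move=> Jy My; have [] : J' i y by rewrite eJ'.
have [y [m [Iy Mm xE]]] := subJ _ _ Jx.
case/orP: hbi => [/asboolP/(_ _ Iy) [j [m' [Jj Mm' yE]]]|/asboolPn nb].
  have -> : x = j + (x - j) by rewrite addrC subrK.
  have [_ D _ _] := idJ i; apply: (D) => //; apply: subJ'.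
    by apply: left_idealB => //; apply: incJ.
  have -> : x - j = m' + m by rewrite xE yE -[j + m' + m]addrA [j + _]addrC addrK.
  by have [_ D' _ _] := idM; apply: D'.
have [_ _ /(_ (I `&` addI (J i.+1) (sumI s))%classic)] := minI.
case=> [|z []//|e0|eI].
- by apply: left_idealI; [case: minI|apply: left_ideal_add].
- have : (I `&` addI (J i.+1) (sumI s))%classic y.
    split=> //; exists x, (- m); split => //; first exact: left_idealN.
    by rewrite xE addrK.
  by rewrite e0 => y0; apply: subJ' => //; rewrite xE y0 add0r.
- by case: nb => z; rewrite -{1}eI => -[].
Qed.

Lemma socle_sumI x : @socle K A x -> exists s : seq (set A),
  (forall I, List.In I s -> minimal_left_ideal I) /\ sumI s x.
Proof.
move=> [ys [h ->]]; elim: ys h => [|y ys IH] h.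
  by exists [::]; split => //=; rewrite big_nil.
have [|s [sm sP]] := IH; first by move=> z zs; apply: h; rewrite inE zs orbT.
have [I [mI Iy]] := h y (mem_head _ _).
exists (I :: s); split; first by move=> J /= [<-//|/sm].
by rewrite big_cons; exists y, (\sum_(z <- ys) z).
Qed.

(** For [x] in the socle, the chains of left ideals on which [x] is a right
    unit have bounded length. *)
Lemma socle_length x : @socle K A x -> exists r, forall (J : nat -> set A) n,
  (forall i, left_ideal (J i)) -> (forall i, (J i `<=` J i.+1)%classic) ->
  (forall i y, J i y -> y = y ** x) ->
  (forall i, (i < n)%N -> J i <> J i.+1) -> (n <= r)%N.
Proof.
move=> /socle_sumI [s [sm sx]]; exists (size s) => J n idJ incJ Jx strict.
have := @chain_length s J n sm idJ incJ; rewrite (eq_bigr (fun=> 1%N)) => [|i _].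
  rewrite sum1_card card_ord; apply => i y /Jx ->.
  by have [_ _ _ M] := left_ideal_sum sm; apply: M.
by case: asboolP => // /(_ (strict i (ltn_ord i))).
Qed.

End Chains.

(** * Semisimplicity forces aperiodic lines *)

Section SemisimpleImpliesLines.
Context (k : nat) (L : kgraph k) (K : comNzRingType).
Implicit Types (u v w : obj L) (a b : mor L) (m n : {ffun 'I_k -> nat}).
Context (Lrf : row_finite L) (Lns : no_sources L).
Local Notation paths := (paths Lrf).

(** The range idempotent s_a s_a^* of a path. *)
Definition kE a : KP L K := kS K a ** kG K a.

Lemma kE_mul a b : deg a = deg b -> kE a ** kE b = if a == b then kE a else 0.
Proof.
move=> ab; rewrite /kE.
have -> : kS K a ** kG K a ** (kS K b ** kG K b)
  = kS K a ** (kG K a ** kS K b) ** kG K b by rewrite !numulA.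
rewrite kG_kS //; case: eqP => [<-|_]; first by rewrite kS_kV.
by rewrite numulr0 numul0r.
Qed.

Lemma kE_mul_sum a (s : seq (mor L)) : uniq s -> {in s, forall b, deg b = deg a} ->
  kE a ** (\sum_(b <- s) kE b) = if a \in s then kE a else 0.
Proof.
move=> us ds; rewrite numul_sumr big_seq.
rewrite (eq_bigr (fun b => if a == b then kE a else 0)) => [|b /ds db]; last by rewrite kE_mul.
rewrite -big_seq -big_mkcond /=; case: ifP => [as_|as_].
  rewrite (big_rem a) //= eqxx big1_seq ?addr0 // => b /andP[/eqP <-].
  by rewrite mem_rem_uniq // inE eqxx.
by rewrite big1_seq // => b /andP[/eqP <-]; rewrite as_.
Qed.

(** The partial sums of the orthogonal idempotents s_a s_a^*, for [a] of degree
    [n], give a strict chain whose length is the number of such paths. *)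
Lemma socle_bounds_paths v : @socle K (KP L K) (kV K v) ->
  exists r, forall n, (size (paths v n) <= r)%N.
Proof.
move=> /socle_length [r hr]; exists r => n; set s := paths v n.
pose q i : KP L K := \sum_(a <- take i s) kE a.
have ds a b : a \in s -> b \in s -> deg b = deg a.
  by move=> /pathsP[_ ->] /pathsP[_ ->].
have ts i : {subset take i s <= s} by move=> x; apply: mem_take.
have qE a i : a \in s -> kE a ** q i = if a \in take i s then kE a else 0.
  move=> as_; apply: kE_mul_sum; first exact/take_uniq/paths_uniq.
  by move=> b /ts; apply: ds.
apply: (hr (fun i => [set y | y = y ** q i]%classic)) => [i|i y /= ->|i y /= ->|i lis] /=.
- split=> [|x y /= ex ey|c x /= ex|c x /= ex] /=; first by rewrite numul0r.
  + by rewrite numulDl -ex -ey.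
  + by rewrite numulZl -ex.
  + by rewrite -numulA -ex.
- rewrite -numulA; congr (_ ** _); rewrite numul_suml big_seq [LHS]big_seq.
  apply: eq_bigr => a ai; rewrite qE; last exact: ts ai.
  by case: ifPn => //; rewrite -(subnKC (leqnSn i)) takeD mem_cat ai.
- rewrite -numulA; congr (_ ** _); rewrite numul_suml big_seq [LHS]big_seq.
  apply: eq_bigr => a /ts /pathsP[<- _].
  by rewrite /kE -numulA kG_kV.
have [a0 _] : exists a0 : mor L, True by case: (s) lis => // a; exists a.
have as_ := mem_nth a0 lis => eJ.
suff : kE (nth a0 s i) = kE (nth a0 s i) ** q i.
  rewrite qE //; case: ifPn => [|_ /eqP]; last by rewrite (negbTE (kSG_neq0 K Lns _)).
  rewrite -{1}(cat_take_drop i s) => ai _.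
  have := paths_uniq Lrf v n; rewrite -/s -(cat_take_drop i s) cat_uniq.
  case/and3P => _ /hasPn /(_ (nth a0 s i)) + _; rewrite (drop_nth a0) // mem_head.
  move=> /(_ isT) /negP; apply.
  by move: ai; rewrite cat_take_drop.
suff : [set y | y = y ** q i.+1]%classic (kE (nth a0 s i)) by rewrite -eJ.
by rewrite /= qE // (take_nth a0) // mem_rcons mem_head.
Qed.

(** A degree with the largest number of paths works. *)
Lemma bounded_paths_line v r : (forall n, (size (paths v n) <= r)%N) ->
  exists n, forall a, rng a = v -> deg a = n -> line (src a).
Proof.
move=> hr; pose P i := `[< exists n, size (paths v n) = i >].
have exP : exists i, P i by exists (size (paths v 0)); apply/asboolP; exists 0.
have ubP i : P i -> (i <= r)%N by move=> /asboolP[n <-].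
case: (ex_maxnP exP ubP) => i /asboolP[n <-] mx; exists n => a ra da b c rb rc dbc.
apply/eqP/negPn/negP => bc.
have : (size (paths v (n + deg b)%R) <= size (paths v n))%N.
  by apply/mx/asboolP; exists (n + deg b).
apply/negP; rewrite -ltnNge.
rewrite (perm_size (pathsD Lrf v n (deg b))) size_flatten /shape -map_comp sumnE big_map.
have as_ : a \in paths v n by apply/pathsP.
rewrite (bigD1_seq a) ?paths_uniq //= size_map.
rewrite -sum1_size (bigD1_seq a) ?paths_uniq //= -addn1 addnAC.
apply: leq_add.
  apply: (@uniq_leq_size _ [:: b; c]); first by rewrite /= inE bc.
  by move=> x; rewrite !inE => /orP[] /eqP->; apply/pathsP.
apply: leq_sum => x _; rewrite size_map.
by have := paths_neq0 Lrf Lns (src x) (deg b); case: (paths _ _).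
Qed.

(** Two paths [a] and [b] of different degrees from a line vertex [w] to the
    same vertex make p_w A p_w contain a unit of infinite order. *)
Section Periodic.
Context (w : obj L) (a b : mor L) (j : 'I_k).
Hypothesis lw : line w.
Hypotheses (ra : rng a = w) (rb : rng b = w) (ab : src a = src b).
Hypothesis dab : (deg b j < deg a j)%N.
Let d := (deg a j - deg b j)%N.

(** The terms s_a s_b^* raised to the powers 2^i, and p_w - (s_a s_b^* )^(2^i). *)
Fixpoint tpow i : aterm K (kpgen L) :=
  if i is i'.+1 then AMul (tpow i') (tpow i') else AMul (kp_s K a) (kp_sst K b).
Definition upow i := AAdd (kp_p K w) (AOpp (tpow i)).

(** The indicator of the paths from [w] whose [j]-th degree is [c] modulo [M]. *)
Definition fper M c (m : mor L) : K :=
  ((rng m == w) && (deg m j == c %[mod M])%N)%:R.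

(** The term s_a s_b^* translates the period-[M] function by [d]. *)
Lemma act_tpow0 M c : eveq (act (tpow 0) (fper M c)) (fper M (c + d)).
Proof.
exists (deg a) => m hm; rewrite /= act_kp_s act_kp_sst /act_path /fper.
case: (eqVneq (rng m) w) => [rm|rm] /=; last first.
  case: (tailP a m) => [[x [ax e _]]|[_ -> //]].
  by rewrite e rng_cmp // ra eqxx in rm.
have [a' [x [ax e da' dx]]] : exists a' x, [/\ src a' = rng x, m = cmp a' x,
    deg a' = deg a & deg x = [ffun i => deg m i - deg a i]%N].
  by apply: factor; apply/ffunP => i; rewrite !ffunE -[LHS](subnKC (hm i)).
have {da' dx} ea : a' = a by apply: lw; rewrite // -rm e rng_cmp.
subst a' m; rewrite tail_cmp // /act_ghost -ab ax eqxx rng_cmp -?ab // rb eqxx /=.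
rewrite !deg_cmp -?ab // !ffunE.
have -> : deg a j + deg x j = (deg b j + deg x j + d)%N.
  by rewrite -[LHS]/(deg a j + deg x j)%N /d; lia.
by rewrite eqn_modDr.
Qed.

Lemma act_tpow i M c : eveq (act (tpow i) (fper M c)) (fper M (c + 2 ^ i * d)).
Proof.
elim: i c => [|i IH] c; first by rewrite mul1n; apply: act_tpow0.
apply: eveq_trans (act_eveq _ (IH c)) _.
by rewrite expnS mul2n -addnn mulnDl addnA; apply: IH.
Qed.

Lemma act_upow i M c :
  eveq (act (upow i) (fper M c)) (fun m : mor L => fper M c m - fper M (c + 2 ^ i * d) m).
Proof.
apply: (eveq2 (act_tpow i M c) (eveq_refl (fper M c))) => m /= -> _.
congr (_ - _); rewrite /act_vertex /fper; case: eqP => //=.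
Qed.

(** The function [fper (2 ^ i.+1 * d) 0] is killed by [upow i.+1] but not by
    [upow i]. *)
Lemma upow_strict i z : kpi (upow i) <> z ** kpi (upow i.+1).
Proof.
have [t ->] := kpi_repr z; rewrite -kpi_mul.
pose M := (2 ^ i.+1 * d)%N.
have d0 : (0 < d)%N by rewrite subn_gt0.
have M0 : (0 < M)%N by rewrite muln_gt0 expn_gt0.
move=> /kpi_act e; have {}e := e (fper M 0).
have {e} [n h] : eveq (fun m : mor L => fper M 0 m - fper M (0 + 2 ^ i * d) m) (fun=> 0).
  apply: eveq_trans (eveq_sym (act_upow _ _ _)) _; apply: eveq_trans e _.
  rewrite -[X in eveq _ X](act0 t) -[act (AMul _ _) _]/(act t (act (upow i.+1) (fper M 0))).
  apply: act_eveq.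
  apply: eveq_trans (act_upow _ _ _) _; exists 0 => m _.
  by rewrite /fper add0n modnn mod0n subrr.
have [m [rm dm]] := Lns w [ffun i => n i * M]%N.
have := h m; rewrite /fper rm eqxx dm ffunE modnMl mod0n eqxx /= add0n.
rewrite modn_small; last by rewrite /M expnS -mulnA ltn_Pmull // muln_gt0 expn_gt0.
rewrite eq_sym muln_eq0 expn_eq0 /= (gtn_eqF d0) subr0 => e.
have /eqP : 1 = 0 :> K by apply: e => i'; rewrite ffunE leq_pmulr.
by rewrite oner_eq0.
Qed.

Lemma tpow_kV i : kpi (tpow i) ** kV K w = kpi (tpow i).
Proof.
elim: i => [|i IH]; rewrite /= kpi_mul -numulA; last by rewrite IH.
by rewrite -rb kG_kV.
Qed.

Lemma kV_tpow i : kV K w ** kpi (tpow i) = kpi (tpow i).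
Proof.
elim: i => [|i IH]; rewrite /= kpi_mul numulA; last by rewrite IH.
by rewrite -ra kV_kS.
Qed.

Lemma upowE i : kpi (upow i) = kV K w - kpi (tpow i).
Proof. by rewrite kpi_add kpi_opp. Qed.

Lemma upow_kV i : kpi (upow i) ** kV K w = kpi (upow i).
Proof. by rewrite upowE numulDl numulNr tpow_kV kV_mul eqxx. Qed.

Lemma kV_upow i : kV K w ** kpi (upow i) = kpi (upow i).
Proof. by rewrite upowE numulDr numulrN kV_tpow kV_mul eqxx. Qed.

Lemma upowS i : kpi (upow i.+1) = (kV K w + kpi (tpow i)) ** kpi (upow i).
Proof.
rewrite numulDl kV_upow !upowE numulDr numulrN tpow_kV /= kpi_mul.
by rewrite addrA subrK.
Qed.

(** The left ideals generated by the [upow i] form a strictly decreasing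
    sequence. *)
Lemma periodic_not_socle : ~ @socle K (KP L K) (kV K w).
Proof.
move=> /socle_length [r hr].
pose D i := [set y | exists z, y = z ** kpi (upow i)]%classic.
have DS i : (D i.+1 `<=` D i)%classic.
  by move=> _ [z ->]; exists (z ** (kV K w + kpi (tpow i))); rewrite upowS numulA.
have : (r.+1 <= r)%N; last by rewrite ltnn.
apply: (hr (fun i => D (r.+1 - i)%N)) => [i|i|i _ [z ->]|i ir].
- split; first by exists 0; rewrite numul0r.
  + by move=> _ _ [x ->] [y ->]; exists (x + y); rewrite numulDl.
  + by move=> c _ [x ->]; exists (c *: x); rewrite numulZl.
  + by move=> c _ [x ->]; exists (c ** x); rewrite numulA.
- by rewrite subnS; case: (r.+1 - i)%N => [//|i']; apply: DS.
- by rewrite -numulA upow_kV.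
rewrite subSn // subSS => eD.
have : D (r - i)%N (kpi (upow (r - i)%N)) by exists (kV K w); rewrite kV_upow.
by rewrite -eD => -[z]; apply: upow_strict.
Qed.

End Periodic.

Lemma semisimple_ends_in_lines : semisimple (KP L K) -> ends_in_lines L.
Proof.
move=> ss v.
have soc w : @socle K (KP L K) (kV K w) by rewrite ss.
have [r hr] := socle_bounds_paths (soc v).
have [n hn] := bounded_paths_line hr.
exists n => c rc dc; have lw := hn c rc dc; split=> // a b ra rb ab.
apply: lw => //; apply/eqP/negPn/negP => ne.
have [j nej] : exists j, deg a j != deg b j.
  apply: contrapT => h; case/eqP: ne; apply/ffunP => j.
  by apply/eqP/negPn/negP => hj; apply: h; exists j.
wlog ltj : a b ra rb ab ne nej / (deg b j < deg a j)%N => [H|].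
  move: (nej); rewrite neq_ltn => /orP[h|h]; last exact: (H a b).
  by apply: (H b a) => //; rewrite eq_sym.
exact: (periodic_not_socle (hn c rc dc) ra rb ab ltj (soc _)).
Qed.

End SemisimpleImpliesLines.

(** * Equality in the talented monoid *)

Section Talented.
Context (k : nat) (L : kgraph k).
Context (Lrf : row_finite L) (Lns : no_sources L).
Implicit Types (u v w : obj L) (a b : mor L) (m : {ffun 'I_k -> nat}).
Implicit Types (n N : {ffun 'I_k -> int}) (ps qs : seq (tgen L)).
Local Notation T := (talented L).
Local Notation paths := (paths Lrf).

(** A degree as an element of Z^k. *)
Definition zvec m : {ffun 'I_k -> int} := [ffun i => (m i)%:Z].

Lemma zvecD m m' : zvec (m + m') = zvec m + zvec m'.
Proof. by apply/ffunP => i; rewrite !ffunE PoszD. Qed.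

Lemma zvec0 : zvec 0 = 0.
Proof. by apply/ffunP => i; rewrite !ffunE. Qed.

Lemma zvec_inj : injective zvec.
Proof. by move=> m m' /ffunP e; apply/ffunP => i; have := e i; rewrite !ffunE => -[]. Qed.

Lemma zvec_gen i : zvec (stdgen nat i) = stdgen int i.
Proof. by apply/ffunP => j; rewrite !ffunE; case: (i == j). Qed.

(** [N - n], as a vector of natural numbers; meaningful only for n <= N. *)
Definition gap N n : {ffun 'I_k -> nat} := [ffun i => `|N i - n i|%N].

(** The product order of Z^k. *)
Definition zle n N : Prop := forall i, n i <= N i.

Lemma zle_trans N n n' : zle n N -> zle N n' -> zle n n'.
Proof. by move=> h h' i; apply: le_trans (h i) (h' i). Qed.

Lemma zle_ub n n' : exists N, zle n N /\ zle n' N.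
Proof.
exists [ffun i => Num.max (n i) (n' i)].
by split=> i; rewrite ffunE le_max lexx ?orbT.
Qed.

Lemma gapK N n : zle n N -> zvec (gap N n) = N - n.
Proof. by move=> h; apply/ffunP => i; rewrite !ffunE gez0_abs // subr_ge0. Qed.

Lemma gapD N n m : zle (n + zvec m) N -> gap N n = m + gap N (n + zvec m).
Proof.
move=> h; apply: zvec_inj; rewrite zvecD !gapK //.
  by rewrite opprD [N + (_ + _)]addrA [zvec m + _]addrC subrK.
by move=> i; apply: le_trans (h i); rewrite !ffunE lerDl.
Qed.

(** The vertices, with multiplicity, obtained by expanding every generator of a
    term up to level [N]; meaningful when [N] is above all of their levels. *)
Fixpoint expd N (t : mterm (tgen L)) : seq (obj L) :=
  match t with
  | MZero => [::]
  | MAdd t t' => expd N t ++ expd N t'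
  | MGen p => [seq src a | a <- paths p.1 (gap N p.2)]
  end.

Lemma expd_big N (I : Type) (s : seq I) F :
  expd N (\big[@MAdd (tgen L)/MZero]_(i <- s) F i)
  = flatten [seq expd N (F i) | i <- s].
Proof. by elim: s => [|i s IH]; rewrite ?big_nil // big_cons /= IH. Qed.

Lemma expd_rel t t' : talented_rel t t' ->
  exists N0, forall N, zle N0 N -> perm_eq (expd N t) (expd N t').
Proof.
move=> [v n i s es s0]; exists (n + stdgen int i) => N hN.
rewrite expd_big /= (@gapD N n (stdgen nat i)) zvec_gen //.
apply: perm_trans (perm_map _ (pathsD Lrf v _ _)) _.
rewrite map_flatten -map_comp.
have -> : [seq expd N (MGen (src a, n + stdgen int i)) | a <- s]
  = map ((map (@src _ L)) \o (fun a => [seq cmp a b | b <- paths (src a) (gap N (n + stdgen int i))])) s.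
  apply: eq_map => a /=; rewrite -map_comp; apply/eq_in_map => b /pathsP[rb _].
  by rewrite /= src_cmp.
apply/perm_flatten/perm_map; exact: enum_perm (paths_enum _ _ _) es.
Qed.

(** The monoid is a direct limit of free monoids: equal elements have the same
    expansion at all sufficiently high levels. *)
Lemma expd_cong t t' : mcong (@talented_rel k L) t t' ->
  exists N0, forall N, zle N0 N -> perm_eq (expd N t) (expd N t').
Proof.
elim=> {t t'}.
- exact: expd_rel.
- by move=> t; exists 0.
- by move=> t t' _ [N0 h]; exists N0 => N /h; rewrite perm_sym.
- move=> t t' t'' _ [N h] _ [N' h']; have [M [NM NM']] := zle_ub N N'.
  exists M => P MP; apply: perm_trans (h _ (zle_trans NM MP)) _.
  exact: h' (zle_trans NM' MP).
- move=> t t' s s' _ [N h] _ [N' h']; have [M [NM NM']] := zle_ub N N'.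
  exists M => P MP /=; apply: perm_cat; first exact: h (zle_trans NM MP).
  exact: h' (zle_trans NM' MP).
- by move=> a b c; exists 0 => N _ /=; rewrite catA.
- by move=> a b; exists 0 => N _ /=; rewrite perm_catC.
- by move=> a; exists 0.
Qed.

(** The element represented by a list of generators, and its expansion. *)
Definition gsum ps : T := \sum_(p <- ps) tvertex p.1 p.2.
Definition gexp N ps : seq (obj L) :=
  flatten [seq [seq src a | a <- paths p.1 (gap N p.2)] | p <- ps].

Lemma gsumE ps : gsum ps = \pi_(presmon (@talented_rel k L))
  (\big[@MAdd (tgen L)/MZero]_(p <- ps) MGen p).
Proof. by rewrite presmon_pi_sum; apply: eq_bigr => -[v n] _. Qed.

Lemma gsum_eq ps qs : gsum ps = gsum qs ->
  exists N0, forall N, zle N0 N -> perm_eq (gexp N ps) (gexp N qs).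
Proof.
rewrite !gsumE => /presmon_piP /expd_cong [N0 h]; exists N0 => N /h.
by rewrite !expd_big.
Qed.

Lemma gsum_cat ps qs : gsum (ps ++ qs) = gsum ps + gsum qs.
Proof. exact: big_cat. Qed.

Lemma gsum1 v n : gsum [:: (v, n)] = tvertex v n.
Proof. exact: big_seq1. Qed.

Lemma gsum_form (x : T) : exists ps, x = gsum ps.
Proof.
have -> : x = \pi_(presmon (@talented_rel k L)) (repr x) by rewrite reprK.
elim: (repr x) => [|t [ps e] t' [ps' e']|p].
- by exists [::]; rewrite /gsum big_nil.
- by exists (ps ++ ps'); rewrite gsum_cat -e -e' [RHS](presmon_addE (@talented_rel k L)).
- by exists [:: p]; case: p => v n; rewrite gsum1.
Qed.

Lemma gsum_nil_eq0 ps : gsum ps = 0 -> ps = [::].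
Proof.
case: ps => // p ps e; have {}e : gsum (p :: ps) = gsum [::] by rewrite e /gsum big_nil.
have [N /(_ N (fun=> lexx _)) /perm_size] := gsum_eq e.
rewrite /gexp /= size_cat size_map.
by have := paths_neq0 Lrf Lns p.1 (gap N p.2); case: (paths _ _).
Qed.

Lemma tvertex_neq0 v n : tvertex v n <> 0.
Proof. by rewrite -gsum1 => /gsum_nil_eq0. Qed.

(** The defining relation of the talented monoid, for every degree. *)
Lemma tvertex_expand v n m :
  tvertex v n = \sum_(a <- paths v m) tvertex (src a) (n + zvec m).
Proof.
pose Q m := forall v n,
  tvertex v n = \sum_(a <- paths v m) tvertex (src a) (n + zvec m).
suff : Q m by apply.
have Q0 : Q 0 by move=> v' n'; rewrite paths0 big_seq1 src_idm zvec0 addr0.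
have QD m1 m2 : Q m1 -> Q m2 -> Q (m1 + m2).
  move=> h1 h2 v' n'; rewrite (perm_big _ (pathsD Lrf v' m1 m2)) /=.
  rewrite big_flatten big_map (h1 v' n'); apply: eq_bigr => a _.
  rewrite (h2 (src a)) big_map zvecD addrA big_seq [RHS]big_seq.
  by apply: eq_bigr => b /pathsP[rb _]; rewrite src_cmp.
have Qg i : Q (stdgen nat i).
  move=> v' n'; rewrite zvec_gen.
  exact: tvertexE (paths_enum _ _ _) (paths_neq0 _ _ _ _).
have -> : m = \sum_i (stdgen nat i *+ m i).
  apply/ffunP => j; rewrite sum_ffunE (bigD1 j) //= big1 => [|i ij].
    by rewrite addr0 ffunMnE ffunE eqxx natn.
  by rewrite ffunMnE ffunE (negbTE ij) mul0rn.
apply: big_ind => // i _; elim: (m i) => [|x IH]; first by rewrite mulr0n.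
by rewrite mulrS; apply: QD.
Qed.

Lemma line_tvertex a n : line (rng a) ->
  tvertex (rng a) n = tvertex (src a) (n + zvec (deg a)).
Proof.
move=> lv; have [b rb e] := line_paths Lrf Lns (deg a) lv.
rewrite (tvertex_expand _ _ (deg a)) e big_seq1.
have /pathsP[_ db] : b \in paths (rng a) (deg a) by rewrite e mem_head.
by rewrite (lv _ _ rb erefl db).
Qed.

End Talented.

(** * Aperiodic atoms *)

(** An aperiodic atom of a talented monoid: an element that is not a sum of
    two nonzero elements and is moved by every nonzero shift. *)
Definition aperiodic_atom (k : nat) (L : kgraph k) (x : talented L) : Prop :=
  [/\ x <> 0, (forall y z, x = y + z -> y = 0 \/ z = 0)
    & forall n, tshift n x = x -> n = 0].

(** Every element is a sum of aperiodic atoms. *)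
Definition atomic (k : nat) (L : kgraph k) : Prop :=
  forall x : talented L, exists s : seq (talented L),
    (forall y, y \in s -> aperiodic_atom y) /\ x = \sum_(y <- s) y.

Section Atoms.
Context (k : nat) (L : kgraph k).
Context (Lrf : row_finite L) (Lns : no_sources L).
Implicit Types (u v w : obj L) (a b : mor L) (m : {ffun 'I_k -> nat}).
Implicit Types (n N : {ffun 'I_k -> int}) (ps qs : seq (tgen L)).
Local Notation T := (talented L).
Local Notation paths := (paths Lrf).
Local Notation gexp := (gexp Lrf).

Lemma size_gexp N ps : (size ps <= size (gexp N ps))%N.
Proof.
elim: ps => // p ps IH; rewrite /gexp /= size_cat size_map.
have := paths_neq0 Lrf Lns p.1 (gap N p.2).
by case: (paths _ _) => //= a s _; rewrite addSn ltnS (leq_trans IH) // leq_addl.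
Qed.

Lemma atom_size1 ps : (forall y z : T, gsum ps = y + z -> y = 0 \/ z = 0) ->
  gsum ps <> 0 -> size ps = 1%N.
Proof.
case: ps => [|p [|q ps]] // h; first by rewrite /gsum big_nil.
have := h (gsum [:: p]) (gsum (q :: ps)); rewrite -gsum_cat => /(_ erefl).
by case=> /(gsum_nil_eq0 Lrf Lns).
Qed.

(** Equal generators at aperiodic line vertices meet at some level [N]. *)
Lemma apline_join u v n n' : apline u -> apline v -> tvertex u n = tvertex v n' ->
  exists N a b, [/\ rng a = u, rng b = v, src a = src b &
    zvec (deg a) = N - n /\ zvec (deg b) = N - n'].
Proof.
move=> [lu _] [lv _]; rewrite -!gsum1 => /(gsum_eq Lrf) [N0 h].
have [N1 [N01 nN1]] := zle_ub N0 n; have [N [N1N n'N]] := zle_ub N1 n'.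
have nN := zle_trans nN1 N1N.
have := h N (zle_trans N01 N1N); rewrite /gexp /= !cats0.
have [a ra ea] := line_paths Lrf Lns (gap N n) lu.
have [b rb eb] := line_paths Lrf Lns (gap N n') lv.
rewrite ea eb /= => /perm_mem /(_ (src a)); rewrite !inE eqxx => /esym/eqP ab.
have /pathsP[_ da] : a \in paths u (gap N n) by rewrite ea mem_head.
have /pathsP[_ db] : b \in paths v (gap N n') by rewrite eb mem_head.
by exists N, a, b; split => //; rewrite da db !gapK.
Qed.

Lemma apline_atom v n : apline v -> aperiodic_atom (tvertex v n).
Proof.
move=> av; have [lv inj] := av; split; first exact: tvertex_neq0.
  move=> y z; have [ps ->] := gsum_form y; have [qs ->] := gsum_form z.
  rewrite -gsum1 -gsum_cat => /(gsum_eq Lrf) [N /(_ N (fun=> lexx _))].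
  move=> /perm_size; rewrite {1}/gexp /= cats0 size_map.
  have [a _ ->] := line_paths Lrf Lns (gap N n) lv => /= e.
  have := size_gexp N (ps ++ qs); rewrite -e size_cat.
  case: ps {e} => [|p ps]; first by left; rewrite /gsum big_nil.
  case: qs => [|q qs]; first by right; rewrite /gsum big_nil.
  by rewrite /= addnS.
move=> n'; rewrite tshift_vertex => /(apline_join av av).
move=> [N [a [b [ra rb ab [da db]]]]].
move: da; rewrite (inj _ _ ra rb ab) db opprD addrA => /eqP.
by rewrite -[X in X == _]addr0 (inj_eq (addrI _)) eq_sym oppr_eq0 => /eqP.
Qed.

Lemma atom_apline v n : aperiodic_atom (tvertex v n) -> apline v.
Proof.
move=> [nz irr aper].
have lv : line v.
  move=> a b ra rb ab.
  pose ps := [seq (src c, n + zvec (deg a)) | c <- paths v (deg a)].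
  have e : tvertex v n = gsum ps by rewrite (tvertex_expand Lrf Lns v n (deg a)) /gsum big_map.
  have : size ps = 1%N by apply: atom_size1; rewrite -e.
  rewrite size_map; case E : (paths v (deg a)) => [|c [|]] // _.
  have : a \in paths v (deg a) by apply/pathsP.
  have : b \in paths v (deg a) by apply/pathsP.
  by rewrite E !inE => /eqP-> /eqP->.
split=> // a b ra rb ab; apply: (lv) => //; apply: zvec_inj; apply/esym/eqP.
rewrite -subr_eq0; apply/eqP/aper; rewrite tshift_vertex -{1}ra line_tvertex // ?ra //.
by rewrite ab -{1}rb [RHS]line_tvertex ?rb // -addrA subrK.
Qed.

Lemma atom_form (x : T) : aperiodic_atom x -> exists v n, apline v /\ x = tvertex v n.
Proof.
move=> h; have [ps e] := gsum_form x; have [nz irr _] := h.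
have : size ps = 1%N by apply: atom_size1; rewrite -e.
case: ps e => [|[v n] [|]] // e _; rewrite gsum1 in e.
by exists v, n; split=> //; apply: (@atom_apline v n); rewrite -e.
Qed.

Lemma ends_in_lines_atomic : ends_in_lines L -> atomic L.
Proof.
move=> h x; have [ps ->] := gsum_form x.
elim: ps => [|[v n] ps [s [sP e]]]; first by exists [::]; rewrite /gsum !big_nil.
have [m hm] := h v.
exists ([seq tvertex (src a) (n + zvec m) | a <- paths v m] ++ s); split.
  move=> y; rewrite mem_cat => /orP[/mapP[a /pathsP[ra da] ->]|/sP//].
  by apply/apline_atom/hm.
by rewrite /gsum big_cons -/(gsum ps) e big_cat big_map -tvertex_expand.
Qed.

Lemma atomic_ends_in_lines : atomic L -> ends_in_lines L.
Proof.
move=> h v; have [s [sP e]] := h (tvertex v 0).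
have [ps [psP es]] : exists ps, (forall p, p \in ps -> apline p.1) /\
    \sum_(y <- s) y = gsum ps.
  elim: s sP {e} => [|y s IH] sP; first by exists [::]; rewrite /gsum !big_nil.
  have [|ps [psP es]] := IH; first by move=> z zs; apply: sP; rewrite inE zs orbT.
  have [w [n [aw ->]]] := atom_form (sP _ (mem_head _ _)).
  exists ((w, n) :: ps); split; last by rewrite big_cons es /gsum big_cons.
  by move=> p; rewrite inE => /orP[/eqP->|/psP].
rewrite es -gsum1 in e; have [N0 hN] := gsum_eq Lrf e.
exists (gap N0 0) => a ra da.
have /perm_mem/(_ (src a)) := hN N0 (fun=> lexx _).
rewrite {1}/gexp /= cats0 map_f; last by apply/pathsP.
move/esym/flatten_mapP => [p pps /mapP[b /pathsP[rb _] ->]].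
by apply: apline_src; rewrite rb; apply: psP.
Qed.

End Atoms.

(** * Transport along an isomorphism of talented monoids *)

Section Transport.
Context (k : nat) (L M : kgraph k) (phi : talented L -> talented M).
Hypothesis iso : talented_isomorphism phi.

Lemma talented_isomorphism_inv : exists psi : talented M -> talented L,
  talented_isomorphism psi /\ cancel phi psi /\ cancel psi phi.
Proof.
have [[phi0 phiD] phiS [psi pK Kp]] := iso; exists psi; split=> //.
split; last by exists phi.
  split; first by rewrite -phi0 pK.
  by move=> x y; apply: (can_inj pK); rewrite phiD !Kp.
by move=> n x; apply: (can_inj pK); rewrite phiS !Kp.
Qed.

Lemma aperiodic_atom_iso x : aperiodic_atom x -> aperiodic_atom (phi x).
Proof.
have [psi [[[psi0 psiD] psiS _] [pK Kp]]] := talented_isomorphism_inv.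
have [[phi0 phiD] phiS _] := iso.
move=> [x0 xi xa]; split.
- by rewrite -phi0 => /(can_inj pK).
- move=> y z e; have [] := xi (psi y) (psi z); first by rewrite -psiD -e pK.
    by rewrite -psi0 => /(can_inj Kp); left.
  by rewrite -psi0 => /(can_inj Kp); right.
- by move=> n; rewrite -phiS => /(can_inj pK)/xa.
Qed.

Lemma atomic_iso : atomic L -> atomic M.
Proof.
have [psi [_ [_ Kp]]] := talented_isomorphism_inv.
have [[phi0 phiD] _ _] := iso.
move=> h y; have [s [sP e]] := h (psi y).
exists [seq phi x | x <- s]; split.
  by move=> _ /mapP[x xs ->]; apply/aperiodic_atom_iso/sP.
rewrite -[LHS]Kp e big_map; elim: s {sP e} => [|x s IH]; first by rewrite !big_nil.
by rewrite !big_cons phiD IH.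
Qed.

End Transport.

(** * Matrix units *)

(** A system of matrix units in [A]: elements [E x y], for [x] and [y] in the
    same fibre of [o], which span [A] and multiply as the elementary matrices
    of a direct sum, over [J], of algebras of finitely supported matrices. The
    values of [E] outside the fibres of [o] are irrelevant. *)
Record matrix_units (K : comNzRingType) (A : nuAlgType K) (X : eqType) (J : Type)
    (o : X -> J) (E : X -> X -> A) : Prop := MatrixUnits {
  mu_mul : forall x y z, o x = o y -> o y = o z -> E x y ** E y z = E x z;
  mu_mul0 : forall x y z t, o x = o y -> o z = o t -> y != z -> E x y ** E z t = 0;
  mu_neq0 : forall x, E x x <> 0;
  mu_span : forall a, lspan (fun e => exists x y, o x = o y /\ e = E x y) a
}.

Section MatrixUnits.
Context (K : fieldType) (X : eqType) (J : Type) (o : X -> J).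

Section One.
Context (A : nuAlgType K) (E : X -> X -> A) (mu : matrix_units o E).

Lemma mu_neq0' x y : o x = o y -> E x y <> 0.
Proof.
move=> xy e; apply: (mu_neq0 mu (x := x)).
by rewrite -(mu_mul mu xy (esym xy)) e numul0r.
Qed.

(** The entry of an element at a pair of indices. *)
Lemma mu_entry a x y : o x = o y -> exists c, E x x ** a ** E y y = c *: E x y.
Proof.
move=> xy; elim: (mu_span mu a) => [|c g z [x' [y' [xy' ->]]] _ [d IH]].
  by exists 0; rewrite numulr0 numul0r scale0r.
rewrite numulDr numulDl IH numulZr numulZl.
case: (eqVneq x x') => [ex|ne]; last first.
  by rewrite (mu_mul0 mu) // numul0r scaler0 add0r; exists d.
case: (eqVneq y' y) => [ey|ne]; last first.
  by rewrite -numulA (mu_mul0 mu) // numulr0 scaler0 add0r; exists d.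
by subst x' y'; rewrite !(mu_mul mu) // -scalerDl; exists (c + d).
Qed.

Lemma mu_entry0 a x y : o x <> o y -> E x x ** a ** E y y = 0.
Proof.
move=> xy; elim: (mu_span mu a) => [|c g z [x' [y' [xy' ->]]] _ IH].
  by rewrite numulr0 numul0r.
rewrite numulDr numulDl IH numulZr numulZl addr0.
case: (eqVneq x x') => [ex|ne]; last by rewrite (mu_mul0 mu) // numul0r scaler0.
case: (eqVneq y' y) => [ey|ne]; last first.
  by rewrite -numulA (mu_mul0 mu) // numulr0 scaler0.
by case: xy; rewrite ex xy' ey.
Qed.

Lemma mu_unit_row (s : seq X) x y : uniq s -> o x = o y ->
  (\sum_(z <- s) E z z) ** E x y = if x \in s then E x y else 0.
Proof.
move=> us xy; rewrite numul_suml.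
rewrite (eq_bigr (fun z => if z == x then E x y else 0)) => [|z _]; last first.
  by case: eqVneq => [->|ne]; [apply: (mu_mul mu)|apply: (mu_mul0 mu)].
rewrite -big_mkcond /=; case: ifP => xs.
  rewrite (big_rem x) //= eqxx big1_seq ?addr0 // => z /andP[/eqP ->].
  by rewrite mem_rem_uniq // inE eqxx.
by rewrite big1_seq // => z /andP[/eqP ->]; rewrite xs.
Qed.

Lemma mu_unit_col (s : seq X) x y : uniq s -> o x = o y ->
  E x y ** (\sum_(z <- s) E z z) = if y \in s then E x y else 0.
Proof.
move=> us xy; rewrite numul_sumr.
rewrite (eq_bigr (fun z => if z == y then E x y else 0)) => [|z _]; last first.
  by case: eqVneq => [->|ne]; [apply: (mu_mul mu)|apply: (mu_mul0 mu); rewrite // eq_sym].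
rewrite -big_mkcond /=; case: ifP => xs.
  rewrite (big_rem y) //= eqxx big1_seq ?addr0 // => z /andP[/eqP ->].
  by rewrite mem_rem_uniq // inE eqxx.
by rewrite big1_seq // => z /andP[/eqP ->]; rewrite xs.
Qed.

Lemma mu_local_unit a : exists s : seq X,
  a = (\sum_(z <- s) E z z) ** a /\ a = a ** (\sum_(z <- s) E z z).
Proof.
suff [s h] : exists s : seq X, forall s', uniq s' -> {subset s <= s'} ->
    a = (\sum_(z <- s') E z z) ** a /\ a = a ** (\sum_(z <- s') E z z).
  by exists (undup s); apply: h; [apply: undup_uniq|move=> z; rewrite mem_undup].
elim: (mu_span mu a) => [|c g z [x [y [xy ->]]] _ [s h]].
  by exists [::] => s' _ _; rewrite numul0r numulr0.
exists [:: x, y & s] => s' us' ss'.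
have [|e1 e2] := h s' us'; first by move=> t ts; apply: ss'; rewrite !inE ts !orbT.
have xs : x \in s' by apply: ss'; rewrite !inE eqxx.
have ys : y \in s' by apply: ss'; rewrite !inE eqxx orbT.
rewrite numulDr numulDl -e1 -e2 numulZr numulZl.
by rewrite mu_unit_row // mu_unit_col // xs ys.
Qed.

(** The column ideals are minimal, so that the algebra equals its socle. *)
Lemma mu_column_minimal y : minimal_left_ideal [set a | a = a ** E y y]%classic.
Proof.
have Eyy : E y y = E y y ** E y y by rewrite (mu_mul mu).
split.
- split=> [|a b /= ea eb|c a /= ea|b a /= ea] /=; first by rewrite numul0r.
  + by rewrite numulDl -ea -eb.
  + by rewrite numulZl -ea.
  + by rewrite -numulA -ea.
- by apply/eqP => e; apply: (mu_neq0 mu (x := y)); rewrite -[_ = 0]/([set 0]%classic _) -e.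
move=> I [I0 ID IZ IM] sub.
case: (pselect (exists2 a, I a & a <> 0)) => [[a Ia a0]|h]; [right|left]; last first.
  by apply/seteqP; split=> [a Ia|a -> //]; apply: contrapT => a0; apply: h; exists a.
apply/seteqP; split=> // b /= ->; apply: (IM).
have ay : a = a ** E y y by apply: sub.
have [s [as_ _]] := mu_local_unit a.
have [x ax] : exists x, E x x ** a <> 0.
  apply: contrapT => h; apply: a0; rewrite as_ numul_suml big1 // => x _.
  by apply: contrapT => hx; apply: h; exists x.
have xy : o x = o y.
  by apply: contrapT => xy; apply: ax; rewrite ay numulA mu_entry0.
have [c ec] := mu_entry a xy.
have c0 : c != 0.
  apply/eqP => c0; apply: ax; rewrite ay numulA ec c0; exact: scale0r.
have -> : E y y = c^-1 *: (E y x ** (E x x ** a)).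
  rewrite ay [E x x ** _]numulA ec numulZr scalerA mulVf // scale1r.
  by rewrite (mu_mul mu).
by apply/IZ/IM/IM.
Qed.

Lemma mu_semisimple : semisimple A.
Proof.
apply/seteqP; split=> // a _.
elim: (mu_span mu a) => [|c g z [x [y [xy ->]]] _ [s [sP ->]]].
  by exists [::]; rewrite big_nil.
exists (c *: E x y :: s); rewrite big_cons; split=> // t.
rewrite inE => /orP[/eqP->|/sP//].
exists [set a | a = a ** E y y]%classic; split; first exact: mu_column_minimal.
by rewrite /= numulZl (mu_mul mu).
Qed.

End One.

Section Two.
Context (A B : nuAlgType K) (E : X -> X -> A) (F : X -> X -> B).
Context (muA : matrix_units o E) (muB : matrix_units o F).

(** The graph of the isomorphism that maps [E x y] to [F x y]. *)
Inductive mu_graph : A -> B -> Prop :=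
  | mu_graph0 : mu_graph 0 0
  | mu_graphS c x y a b : o x = o y -> mu_graph a b ->
      mu_graph (c *: E x y + a) (c *: F x y + b).

Lemma mu_graphD a b a' b' : mu_graph a b -> mu_graph a' b' -> mu_graph (a + a') (b + b').
Proof.
move=> + h'; elim=> [|c x y a1 b1 xy _ IH]; first by rewrite !add0r.
by rewrite -!addrA; apply: mu_graphS.
Qed.

Lemma mu_graphZ c a b : mu_graph a b -> mu_graph (c *: a) (c *: b).
Proof.
elim=> [|d x y a1 b1 xy _ IH]; first by rewrite !scaler0; apply: mu_graph0.
by rewrite !scalerDr !scalerA; apply: mu_graphS.
Qed.

Lemma mu_graphM a b a' b' : mu_graph a b -> mu_graph a' b' -> mu_graph (a ** a') (b ** b').
Proof.
move=> + h'; elim=> [|c x y a1 b1 xy _ IH]; first by rewrite !numul0r; apply: mu_graph0.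
rewrite !numulDl !numulZl; apply: mu_graphD => //; apply: mu_graphZ.
elim: h' => [|d z t a2 b2 zt _ IH']; first by rewrite !numulr0; apply: mu_graph0.
rewrite !numulDr !numulZr; apply: mu_graphD => //; apply: mu_graphZ.
case: (eqVneq y z) => [yz|yz].
  subst z; rewrite (mu_mul muA) // (mu_mul muB) // -[E _ _]addr0 -[F _ _]addr0.
  rewrite -[E x t]scale1r -[F x t]scale1r; apply: mu_graphS; first by rewrite xy.
  exact: mu_graph0.
by rewrite (mu_mul0 muA) // (mu_mul0 muB) //; apply: mu_graph0.
Qed.

Lemma mu_graph_total a : exists b, mu_graph a b.
Proof.
elim: (mu_span muA a) => [|c g z [x [y [xy ->]]] _ [b IH]].
  by exists 0; apply: mu_graph0.
by exists (c *: F x y + b); apply: mu_graphS.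
Qed.

Lemma mu_graph_entry a b x y : o x = o y -> mu_graph a b ->
  exists c, E x x ** a ** E y y = c *: E x y /\ F x x ** b ** F y y = c *: F x y.
Proof.
move=> xy; elim=> [|c x' y' a1 b1 xy' _ [d [IH IH']]].
  by exists 0; rewrite !numulr0 !numul0r !scale0r.
rewrite !numulDr !numulDl IH IH' !numulZr !numulZl.
case: (eqVneq x x') => [ex|ne]; last first.
  rewrite (mu_mul0 muA) // (mu_mul0 muB) // !numul0r !scaler0 !add0r.
  by exists d.
case: (eqVneq y' y) => [ey|ne]; last first.
  rewrite -!numulA (mu_mul0 muA) // (mu_mul0 muB) // !numulr0 !scaler0 !add0r.
  by exists d.
by subst x' y'; rewrite !(mu_mul muA) // !(mu_mul muB) // -!scalerDl; exists (c + d).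
Qed.

(** The graph is single-valued at 0, because an element is determined by its
    entries. *)
Lemma mu_graph_eq0 a b : mu_graph a b -> a = 0 -> b = 0.
Proof.
move=> h a0; have [s [bl br]] := mu_local_unit muB b.
rewrite bl br numul_suml big1 // => x _; rewrite !numul_sumr big1 // => y _.
rewrite numulA.
case: (pselect (o x = o y)) => xy; last exact: mu_entry0.
have [c [e ->]] := mu_graph_entry xy h.
case: (eqVneq c 0) => [->|c0]; first by rewrite scale0r.
case: (mu_neq0' muA xy); move/(congr1 ( *:%R c^-1)): e.
by rewrite a0 numulr0 numul0r scaler0 scalerA mulVf // scale1r.
Qed.

Lemma mu_graph_fun a b b' : mu_graph a b -> mu_graph a b' -> b = b'.
Proof.
move=> h /(mu_graphZ (-1)) h'; apply/eqP; rewrite -subr_eq0 -scaleN1r; apply/eqP.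
by apply: mu_graph_eq0 (mu_graphD h h') _; rewrite scaleN1r subrr.
Qed.

End Two.

Lemma mu_graph_sym (A B : nuAlgType K) (E : X -> X -> A) (F : X -> X -> B) a b :
  mu_graph E F a b -> mu_graph F E b a.
Proof. by elim=> [|c x y a1 b1 xy _ IH]; [apply: mu_graph0|apply: mu_graphS]. Qed.

Lemma mu_isomorphic (A B : nuAlgType K) (E : X -> X -> A) (F : X -> X -> B) :
  matrix_units o E -> matrix_units o F -> nualg_isomorphic A B.
Proof.
move=> muA muB.
have [f fP] := choice (mu_graph_total F muA).
have [g gP] := choice (mu_graph_total E muB).
have fun_AB := mu_graph_fun muA muB; have fun_BA := mu_graph_fun muB muA.
exists f; split; [split|exists g].
- move=> c a a'; apply: fun_AB (fP _) _.
  by apply: mu_graphD => //; apply: mu_graphZ.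
- move=> a a'; apply: fun_AB (fP _) _.
  exact: mu_graphM.
- by move=> a; apply: fun_BA (gP _) _; apply/mu_graph_sym/fP.
- by move=> b; apply: fun_AB (fP _) _; apply/mu_graph_sym/gP.
Qed.

End MatrixUnits.

(** * The matrix units of a Kumjian-Pask algebra *)

(** Countably many representatives for an equivalence relation on a subset of a
    countable type with infinitely many classes. *)
Lemma countable_transversal (C : countType) (P : C -> Prop) (R : C -> C -> Prop)
    (s : nat -> C) :
  (forall c, P c -> R c c) -> (forall c d, R c d -> R d c) ->
  (forall c d e, P d -> R c d -> R d e -> R c e) ->
  (forall i, P (s i)) -> (forall i j, R (s i) (s j) -> i = j) ->
  exists b : nat -> C, [/\ forall i, P (b i), forall i j, R (b i) (b j) -> i = j
    & forall c, P c -> exists i, R c (b i)].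
Proof.
move=> Rr Rs Rt Ps sR.
(* The representative of a class is its element of least code. *)
pose Q := [set c | P c /\ forall d, P d -> R c d -> (pickle c <= pickle d)%N]%classic.
have repP c : P c -> exists2 d, Q d & R c d.
  move=> Pc; pose N n := `[< exists d, [/\ P d, R c d & pickle d = n] >].
  have exN : exists n, N n by exists (pickle c); apply/asboolP; exists c; split=> //; apply: Rr.
  case: (ex_minnP exN) => n /asboolP[d [Pd cd <-]] dmin.
  exists d => //; split=> // e Pe de; apply: dmin; apply/asboolP; exists e; split=> //.
  exact: Rt Pd cd de.
have Quniq c d : Q c -> Q d -> R c d -> c = d.
  move=> [Pc cmin] [Pd dmin] cd; apply: (pcan_inj pickleK); apply/eqP.
  by rewrite eqn_leq cmin // dmin //; apply: Rs.
have [g gP] : {g : nat -> C & forall i, Q (g i) /\ R (s i) (g i)}.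
  apply: (@choice _ _ (fun i d => Q d /\ R (s i) d)) => i.
  by have [d Qd sd] := repP _ (Ps i); exists d.
have ginj : injective g.
  move=> i j e; apply: sR; have [[Pg _] si] := gP i; have [_ sj] := gP j.
  by apply: Rt Pg si _; rewrite e; apply: Rs.
have Qinf : infinite_set Q.
  apply: (@sub_infinite_set _ (range g)).
    by move=> _ [i _ <-]; case: (gP i).
  rewrite (eq_finite_set (inj_card_eq _)); last by move=> i j _ _; apply: ginj.
  exact: infinite_nat.
have /card_set_bijP[f [_ finj fsurj]] := eq_card_nat (countableP Q) Qinf.
have [b bP] : {b : nat -> C & forall i, Q (b i) /\ f (b i) = i}.
  apply: (@choice _ _ (fun i d => Q d /\ f d = i)) => i.
  by have [d Qd fd] := fsurj i I; exists d.
exists b; split=> [i|i j bij|c Pc].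
- by have [[]] := bP i.
- have [Qi <-] := bP i; have [Qj <-] := bP j.
  by rewrite (Quniq _ _ Qi Qj bij).
have [d Qd cd] := repP c Pc; exists (f d).
have [Qb fb] := bP (f d).
by have -> : b (f d) = d by apply: finj => //; apply/mem_set.
Qed.

Section PathMatrixUnits.
Context (k : nat) (L : kgraph k) (K : fieldType).
Context (Lrf : row_finite L) (Lns : no_sources L).
Implicit Types (u v w : obj L) (a b c d : mor L).
Implicit Types (n N : {ffun 'I_k -> int}).
Local Notation paths := (paths Lrf).

(** For paths ending at line vertices: the infinite paths that extend [a] and
    [b] are equal. *)
Definition same_end a b : Prop :=
  exists c d, [/\ src a = rng c, src b = rng d & cmp a c = cmp b d].

Lemma same_end_refl a : same_end a a.
Proof. by exists (idm (src a)), (idm (src a)); rewrite rng_idm. Qed.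

Lemma same_end_sym a b : same_end a b -> same_end b a.
Proof. by move=> [c [d [? ? ?]]]; exists d, c. Qed.

Lemma same_end_trans a b c : line (src b) ->
  same_end a b -> same_end b c -> same_end a c.
Proof.
move=> lb [x [y [ax b_y e]]] [x' [y' [bx' cy' e']]].
have [p [q [yp x'q epq]]] : exists p q, [/\ src y = rng p, src x' = rng q & cmp y p = cmp x' q].
  by apply: line_join => //; rewrite -b_y.
have xp : src x = rng p by rewrite -(src_cmp ax) e src_cmp.
have y'q : src y' = rng q by rewrite -(src_cmp cy') -e' src_cmp.
exists (cmp x p), (cmp y' q); rewrite !rng_cmp //; split => //.
by rewrite cmpA // e -cmpA // epq !cmpA // e'.
Qed.

Lemma kSG_line_extend a b c : src a = src b -> line (src a) -> src a = rng c ->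
  kS K a ** kG K b = kS K (cmp a c) ** kG K (cmp b c).
Proof.
move=> ab la ac; rewrite (kSG_expand K Lrf (deg c) ab).
have [x rx e] := line_paths Lrf Lns (deg c) la.
have : c \in paths (src a) (deg c) by apply/pathsP.
by rewrite e inE => /eqP <-; rewrite big_seq1.
Qed.

(** [x] is the matrix unit of the infinite paths that extend [a] and [b]. *)
Definition path_unit a b (x : KP L K) : Prop := exists c d,
  [/\ src a = rng c, src b = rng d, src c = src d
    & x = kS K (cmp a c) ** kG K (cmp b d)].

(** Any two choices of extensions have a common extension, at which they agree
    because the line at the end of [b] is aperiodic. *)
Lemma path_unit_uniq a b x y : apline (src a) -> apline (src b) ->
  path_unit a b x -> path_unit a b y -> x = y.
Proof.
move=> [la _] [_ ib] [c [d [ac bd cd ->]]] [c' [d' [ac' bd' cd' ->]]].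
have [p [q [cp c'q e]]] : exists p q,
    [/\ src c = rng p, src c' = rng q & cmp c p = cmp c' q].
  by apply: line_join => //; rewrite -ac.
have dp : src d = rng p by rewrite -cd.
have d'q : src d' = rng q by rewrite -cd'.
have e' : cmp d p = cmp d' q.
  apply: ib; rewrite ?rng_cmp // !src_cmp //.
  by rewrite -(src_cmp cp) e src_cmp.
rewrite (@kSG_line_extend _ _ p) ?src_cmp //; last by apply: line_src; rewrite -ac.
rewrite (@kSG_line_extend (cmp a c') _ q) ?src_cmp //; last by apply: line_src; rewrite -ac'.
by rewrite -!cmpA // e e'.
Qed.

Lemma path_unit_mul a b c x y : line (src a) -> line (src b) -> line (src c) ->
  path_unit a b x -> path_unit b c y -> path_unit a c (x ** y).
Proof.
move=> la lb lc [p [q [ap bq pq ->]]] [p' [q' [bp' cq' pq' ->]]].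
have [r [t [qr p't e]]] : exists r t,
    [/\ src q = rng r, src p' = rng t & cmp q r = cmp p' t].
  by apply: line_join => //; rewrite -bq.
have pr : src p = rng r by rewrite pq.
have q't : src q' = rng t by rewrite -pq'.
exists (cmp p r), (cmp q' t); rewrite !rng_cmp // !src_cmp //; split=> //.
  by rewrite -(src_cmp qr) e src_cmp.
rewrite (@kSG_line_extend _ _ r) ?src_cmp //; last by apply: line_src; rewrite -ap.
rewrite (@kSG_line_extend (cmp b p') _ t) ?src_cmp //; last by apply: line_src; rewrite -bp'.
rewrite -!cmpA // -e.
have eX : src (cmp b (cmp q r)) = src (cmp a (cmp p r)) by rewrite !src_cmp ?rng_cmp.
by rewrite -numulA [X in _ ** X]numulA kG_kS_id numulA eX kS_kV.
Qed.

Lemma path_unit_mul0 a b b' c x y : ~ same_end b b' ->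
  path_unit a b x -> path_unit b' c y -> x ** y = 0.
Proof.
move=> nb [p [q [ap bq pq ->]]] [p' [q' [bp' cq' pq' ->]]].
rewrite -!numulA [X in _ ** X]numulA (kG_kS_expand K Lrf) big_seq big1; last first.
  move=> r /pathsP[rr _]; rewrite big_seq big1 // => t /pathsP[rt _].
  case: eqP => // e; case: nb; exists (cmp q r), (cmp p' t).
  by rewrite src_cmp // in rr; rewrite src_cmp // in rt; rewrite !rng_cmp // !cmpA.
by rewrite numul0r numulr0.
Qed.

(** From here on, [tau] lists one element of each shift orbit of aperiodic
    atoms. *)
Context (k_gt0 : (0 < k)%N) (ends : ends_in_lines L).
Context (J : eqType) (tau : J -> talented L).
Hypothesis tau_atom : forall j, aperiodic_atom (tau j).
Hypothesis tau_inj : forall i j n, tshift n (tau i) = tau j -> i = j.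
Hypothesis tau_surj : forall x : talented L, aperiodic_atom x ->
  exists j n, x = tshift n (tau j).

(** The vertex [v], at level 0, lies in the orbit of [tau j]. *)
Definition in_orbit j v : Prop := exists n, tvertex v 0 = tshift n (tau j).

Lemma apline_in_orbit v : apline v -> exists j, in_orbit j v.
Proof. by move=> /(apline_atom Lrf Lns 0) /tau_surj [j [n e]]; exists j, n. Qed.

Lemma in_orbit_uniq i j v : in_orbit i v -> in_orbit j v -> i = j.
Proof.
move=> [n e] [m e']; apply: (@tau_inj _ _ (- m + n)).
by rewrite tshiftD -e e' -tshiftD addNr tshift0.
Qed.

Lemma in_orbit_apline j v : in_orbit j v -> apline v.
Proof.
move=> [n e].
apply: (@atom_apline k L Lrf Lns v (- n)).
by rewrite -[- n]add0r -tshift_vertex e -tshiftD addNr tshift0.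
Qed.

Lemma in_orbit_src j a : in_orbit j (rng a) -> in_orbit j (src a).
Proof.
move=> h; have [la _] := in_orbit_apline h; have [n e] := h.
exists (- zvec (deg a) + n); rewrite tshiftD -e (line_tvertex Lrf Lns) //.
by rewrite tshift_vertex add0r subrr.
Qed.

Lemma in_orbit_join j u v : in_orbit j u -> in_orbit j v ->
  exists a b, [/\ rng a = u, rng b = v & src a = src b].
Proof.
move=> hu hv; have au := in_orbit_apline hu; have av := in_orbit_apline hv.
have [n e] := hu; have [m e'] := hv.
have : tvertex u 0 = tvertex v (n - m).
  by rewrite -[n - m]add0r -tshift_vertex e' -tshiftD subrK.
move=> /(apline_join Lrf Lns au av) [_ [a [b [ra rb ab _]]]].
by exists a, b.
Qed.

Lemma orbit_nonempty j : exists v, in_orbit j v.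
Proof.
have [v [n [_ e]]] := atom_form Lrf Lns (tau_atom j).
by exists v, (- n); rewrite e tshift_vertex subrr.
Qed.

Lemma same_end_orbit i j a b : same_end a b ->
  in_orbit i (src a) -> in_orbit j (src b) -> i = j.
Proof.
move=> [c [d [ac bd e]]]; rewrite ac bd => /in_orbit_src hc /in_orbit_src hd.
apply: in_orbit_uniq hc _.
by rewrite -(src_cmp ac) e src_cmp.
Qed.

(** One path for each class of the paths whose source lies in the orbit [j];
    the classes are infinite in number because the vertices on an aperiodic
    line are distinct. *)
Lemma orbit_paths j : exists b : nat -> mor L,
  [/\ forall i, in_orbit j (src (b i)),
      forall i i', same_end (b i) (b i') -> i = i'
    & forall a, in_orbit j (src a) -> exists i, same_end a (b i)].
Proof.
have [v hv] := orbit_nonempty j; have [lv iv] := in_orbit_apline hv.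
have ex i : exists a, rng a = v /\ deg a = [ffun=> i] by apply: Lns.
have [r rP] := choice ex.
apply: (@countable_transversal _ _ same_end (fun i => idm (src (r i)))).
- by move=> a _; apply: same_end_refl.
- exact: same_end_sym.
- by move=> a b c /in_orbit_apline[lb _]; apply: same_end_trans.
- by move=> i; rewrite src_idm; apply: in_orbit_src; have [-> _] := rP i.
move=> i i' [c [d [rc rd e]]]; rewrite !src_idm in rc rd.
have sr : src (r i) = src (r i').
  move: (congr1 (@rng k L) e).
  by rewrite !rng_cmp ?src_idm // !rng_idm.
have [ri di] := rP i; have [ri' di'] := rP i'.
have := iv _ _ ri ri' sr => /(congr1 (@deg k L)).
rewrite di di' => /ffunP /(_ (Ordinal k_gt0)); by rewrite !ffunE.
Qed.

(** The algebra is a direct sum, over the orbits of aperiodic atoms, of algebras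
    of finitely supported matrices indexed by [nat]. *)
Lemma path_matrix_units : exists E : J * nat -> J * nat -> KP L K,
  matrix_units (@fst J nat) E.
Proof.
have [b bP] := choice orbit_paths.
pose B (x : J * nat) := b x.1 x.2.
have BO x : in_orbit x.1 (src (B x)) by have [h _ _] := bP x.1; apply: h.
have Bap x : apline (src (B x)) by apply: in_orbit_apline (BO x).
have Bl x : line (src (B x)) by have [] := Bap x.
have Binj x y : same_end (B x) (B y) -> x = y.
  move=> h; have := same_end_orbit h (BO x) (BO y).
  case: x y h => [j i] [j' i'] /= h e; subst j'; congr (_, _).
  by have [_ + _] := bP j; apply.
have [E EP] : {E : (J * nat) * (J * nat) -> KP L K &
    forall p, p.1.1 = p.2.1 -> path_unit (B p.1) (B p.2) (E p)}.
  apply: (@choice _ _ (fun p x => p.1.1 = p.2.1 -> path_unit (B p.1) (B p.2) x)).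
  move=> [x y] /=; case: (pselect (x.1 = y.1)) => [e|]; last by exists 0.
  have hy := BO y; rewrite -e in hy.
  have [c [d [rc rd cd]]] := in_orbit_join (BO x) hy.
  by exists (kS K (cmp (B x) c) ** kG K (cmp (B y) d)) => _; exists c, d.
exists (fun x y => E (x, y)); split.
- move=> x y z xy yz; have xz := etrans xy yz.
  apply: (@path_unit_uniq (B x) (B z)) => //; last exact: (EP (x, z)).
  by apply: (@path_unit_mul _ (B y)) => //; [apply: (EP (x, y))|apply: (EP (y, z))].
- move=> x y z t xy zt /eqP yz.
  apply: (@path_unit_mul0 (B x) (B y) (B z) (B t)).
  + by move=> /Binj.
  + exact: (EP (x, y)).
  + exact: (EP (z, t)).
- move=> x; have [c [d [xc xd cd ->]]] := EP (x, x) erefl.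
  rewrite /= in xc xd *.
  have [_ ix] := Bap x; rewrite (ix c d) //.
  by apply/eqP/kSG_neq0.
move=> x; apply: lspan_trans (kp_span Lrf x) => _ [p [q [pq ->]]].
have [n hn] := ends (src p); rewrite (kSG_expand K Lrf n pq) big_seq.
apply: lspan_sum => c /pathsP[rc dc]; apply: lspan_gen.
have ac := hn c rc dc; have [j hj] := apline_in_orbit ac.
have spc : src (cmp p c) = src c by rewrite src_cmp.
have sqc : src (cmp q c) = src c by rewrite src_cmp // -pq.
have [_ _ surj] := bP j.
have [|i [z [t [pz bt e]]]] := surj (cmp p c); first by rewrite spc.
have [|i' [z' [t' [qz' bt' e']]]] := surj (cmp q c); first by rewrite sqc.
exists (j, i), (j, i'); split => //.
have [lc _] := ac; rewrite spc in pz; rewrite sqc in qz'.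
have [r [r' [zr z'r' er]]] : exists r r',
    [/\ src z = rng r, src z' = rng r' & cmp z r = cmp z' r'].
  by apply: (line_join Lns); rewrite -pz.
have tr : src t = rng r by rewrite -(src_cmp bt) -e src_cmp ?spc.
have t'r' : src t' = rng r' by rewrite -(src_cmp bt') -e' src_cmp ?sqc.
apply: (@path_unit_uniq (b j i) (b j i')).
- exact: (Bap (j, i)).
- exact: (Bap (j, i')).
- exists (cmp t r), (cmp t' r'); rewrite !rng_cmp // !src_cmp //; split=> //.
    by rewrite -(src_cmp zr) er src_cmp.
  rewrite (@kSG_line_extend _ _ (cmp z r)) ?spc ?sqc ?rng_cmp //.
  by rewrite {2}er !cmpA ?spc ?sqc // e e'.
exact: (EP ((j, i), (j, i'))).
Qed.

End PathMatrixUnits.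

(** * Orbits of aperiodic atoms and the theorem *)

(** [tau] lists one element of each shift orbit of aperiodic atoms. *)
Definition atom_transversal (k : nat) (L : kgraph k) (J : Type)
    (tau : J -> talented L) : Prop :=
  [/\ forall j, aperiodic_atom (tau j),
      forall i j n, tshift n (tau i) = tau j -> i = j
    & forall x, aperiodic_atom x -> exists j n, x = tshift n (tau j)].

Lemma tshiftK (k : nat) (L : kgraph k) n : cancel (@tshift k L n) (tshift (- n)).
Proof. by move=> x; rewrite -tshiftD addNr tshift0. Qed.

Lemma aperiodic_atom_shift (k : nat) (L : kgraph k) n (x : talented L) :
  aperiodic_atom x -> aperiodic_atom (tshift n x).
Proof.
move=> [x0 xi xa]; split.
- by move=> e; apply: x0; rewrite -[x](tshiftK n) e raddf0.
- move=> y z e; have [] := xi (tshift (- n) y) (tshift (- n) z).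
  + by rewrite -[LHS](tshiftK n) e raddfD.
  + by move=> e'; left; rewrite -[y](tshiftK (- n)) e' raddf0.
  + by move=> e'; right; rewrite -[z](tshiftK (- n)) e' raddf0.
- move=> m e; apply/xa/(can_inj (@tshiftK _ _ n)).
  by rewrite -tshiftD addrC tshiftD.
Qed.

Lemma atom_transversal_exists (k : nat) (L : kgraph k) :
  exists (J : eqType) (tau : J -> talented L), atom_transversal tau.
Proof.
pose orb (x y : talented L) := `[< exists n, y = tshift n x >].
have orb_refl x : orb x x by apply/asboolP; exists 0; rewrite tshift0.
have orb_shift n x : orb (tshift n x) =1 orb x.
  move=> y; apply/asboolP/asboolP => -[m ->].
    by exists (m + n); rewrite tshiftD.
  by exists (m - n); rewrite -tshiftD subrK.
pose rep x := choose (orb x) x.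
have rep_shift n x : rep (tshift n x) = rep x.
  rewrite /rep (eq_choose (orb_shift n x)); apply: choose_id; last exact: orb_refl.
  by rewrite -(orb_shift n).
have repP x : exists n, rep x = tshift n x.
  by have /asboolP := chooseP (orb_refl x).
pose p x := `[< aperiodic_atom x /\ rep x = x >].
exists ({x : talented L | p x}%type : eqType), (fun x => val x); split.
- by move=> [x /= /asboolP[]].
- move=> [x /= px] [y /= py] n e; apply: val_inj => /=.
  have /asboolP[_ <-] := px; have /asboolP[_ <-] := py.
  by rewrite -e rep_shift.
move=> x ax; have [n en] := repP x.
have px : p (rep x).
  apply/asboolP; rewrite {2}en rep_shift; split=> //.
  by rewrite en; apply: aperiodic_atom_shift.
by exists (Sub (rep x) px), (- n); rewrite SubK en tshiftK.
Qed.

Lemma atom_transversal_iso (k : nat) (L M : kgraph k)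
    (phi : talented L -> talented M) (J : Type) (tau : J -> talented L) :
  talented_isomorphism phi -> atom_transversal tau -> atom_transversal (phi \o tau).
Proof.
move=> iso [ta ti ts]; have [psi [iso' [pK Kp]]] := talented_isomorphism_inv iso.
have [_ phiS _] := iso; split=> [j|i j n /=|y ay] /=.
- by apply: aperiodic_atom_iso iso _ _.
- by rewrite -phiS => /(can_inj pK) /ti.
have [j [n e]] := ts _ (aperiodic_atom_iso iso' ay).
by exists j, n; rewrite /= -phiS -e Kp.
Qed.

Lemma ends_in_lines_semisimple (k : nat) (L : kgraph k) (K : fieldType) :
  (0 < k)%N -> row_finite L -> no_sources L -> ends_in_lines L ->
  semisimple (KP L K).
Proof.
move=> k_gt0 Lrf Lns ends; have [J [tau [ta ti ts]]] := atom_transversal_exists L.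
have [E mu] := path_matrix_units K Lrf Lns k_gt0 ends ta ti ts.
exact: mu_semisimple mu.
Qed.

Lemma semisimple_iso (k : nat) (L M : kgraph k) (K : fieldType)
    (phi : talented L -> talented M) :
  (0 < k)%N -> row_finite L -> no_sources L -> row_finite M -> no_sources M ->
  talented_isomorphism phi -> semisimple (KP L K) -> semisimple (KP M K).
Proof.
move=> k_gt0 Lrf Lns Mrf Mns iso /(semisimple_ends_in_lines Lrf Lns) ends.
apply: ends_in_lines_semisimple => //; apply: (atomic_ends_in_lines Mrf Mns).
exact/(atomic_iso iso)/ends_in_lines_atomic.
Qed.

Theorem theorem5p15 (k : nat) (Lambda Omega : kgraph k) (K : fieldType)
    (phi : talented Lambda -> talented Omega) :
  (0 < k)%N ->
  row_finite Lambda -> no_sources Lambda ->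
  row_finite Omega -> no_sources Omega ->
  talented_isomorphism phi ->
  (semisimple (KP Lambda K) <-> semisimple (KP Omega K)) /\
  (semisimple (KP Lambda K) -> talented_fin_gen Lambda ->
   nualg_isomorphic (KP Lambda K) (KP Omega K)).
Proof.
move=> k_gt0 Lrf Lns Orf Ons iso.
have [psi [iso' _]] := talented_isomorphism_inv iso.
split; first by split; apply: semisimple_iso; eassumption.
move=> ss _; have ss' := semisimple_iso k_gt0 Lrf Lns Orf Ons iso ss.
have endsL := semisimple_ends_in_lines Lrf Lns ss.
have endsO := semisimple_ends_in_lines Orf Ons ss'.
(* The two systems of matrix units are indexed by the same set, a transversal
   of the aperiodic atoms of the first monoid, transported by [phi]. *)
have [J [tau tauP]] := atom_transversal_exists Lambda.
have [ta ti ts] := tauP; have [ta' ti' ts'] := atom_transversal_iso iso tauP.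
have [E muE] := path_matrix_units K Lrf Lns k_gt0 endsL ta ti ts.
have [F muF] := path_matrix_units K Orf Ons k_gt0 endsO ta' ti' ts'.
exact: mu_isomorphic muE muF.
Qed.
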